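(* Let $K$ be an equivelar triangulation of a surface $S$, with $n$ vertices, and let $M$ be the dual map of $K$ on $S$. Then the edge graph $EG(K)$ has a contractible Hamiltonian cycle if and only if the edge graph of $M$ has a proper tree.
   Context: Graphs have no loops and at most one edge joins any two vertices. A surface is a closed connected 2-manifold. A map on a surface $S$ is an embedding of a graph $G$ with finitely many vertices in $S$ such that the components of $S\setminus G$ are topological 2-cells, the closure of each of which (a face) is a 2-disk whose boundary is a $p$-gon for some integer $p\ge 3$. A map is of type $\{p,q\}$ (i.e. $\{p,q\}$ equivelar) if all its faces are $p$-gons and each vertex is incident with exactly $q$ of them. A triangulation of $S$ is a map that is a simplicial complex (each face is a simplex, i.e. a triangle). It is equivelar (or degree-regular of type $q$) if each vertex is incident with exactly $q$ triangles, i.e. it is of type $\{3,q\}$. The edge graph of a map consists of its vertices and edges, and is denoted $EG(K)$ for a simplicial complex $K$. The dual map $M$ of $K$ has one vertex for each triangle of $K$, one face for each vertex of $K$, and two of its vertices are adjacent when the corresponding triangles share an edge. If $K$ is of type $\{3,q\}$, then $M$ is of type $\{q,3\}$. A tree is a connected graph without cycles. A Hamiltonian cycle in $EG(K)$ is a cycle passing through every vertex of $K$ exactly once. It is contractible if it is null-homotopic in $S$ (equivalently, it bounds a 2-disk in $S$). Proper tree: let $M$ be the dual map of an $n$-vertex degree-regular triangulation $K$ of type $q$ of $S$. A proper tree in $M$ is a subgraph $T$ of the edge graph of $M$ that is a tree on exactly $n-2$ vertices and satisfies: (1) whenever two vertices $u_1,u_2$ of $T$ belong to a face $F$ of $M$,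 a path $P[u_1,u_2]$ joining $u_1$ and $u_2$ in the boundary of $F$ belongs to $T$; (2) any path in $T$ which lies in a face $F$ of $M$ has length (number of edges) at most $q-2$. *)

(* Defs.v *)
From HB Require Import structures.
From mathcomp Require Import all_boot all_order all_algebra.
From mathcomp Require Import all_classical all_reals all_analysis.

Set Implicit Arguments.
Unset Strict Implicit.
Unset Printing Implicit Defensive.

Import Order.TTheory GRing.Theory Num.Theory.
Import numFieldNormedType.Exports.

Local Open Scope classical_set_scope.
Local Open Scope ring_scope.

Definition homeomorphism_on (X Y : topologicalType) (A : set X) (B : set Y)
    (f : X -> Y) : Prop :=
  exists g : Y -> X,
    [/\ set_fun A B f, set_fun B A g,
        (forall x, A x -> g (f x) = x) /\ (forall y, B y -> f (g y) = y),
        {within A, continuous f} & {within B, continuous g}].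

(* Second countability is automatic for a compact locally Euclidean space. *)
Definition closed_surface (R : realType) (S : topologicalType) : Prop :=
  [/\ [set: S] !=set0, hausdorff_space S, compact [set: S], connected [set: S]
    & forall p : S, exists (U : set S) (W : set 'rV[R]_2) (f : S -> 'rV[R]_2),
        [/\ open U, U p, open W & homeomorphism_on U W f]].

(* The inclusion of A into S is homotopic to a constant map. When A is the
   image of an embedded circle, this says that the closed curve is freely
   homotopic to a point. *)
Definition null_homotopic_in (R : realType) (S : topologicalType) (A : set S)
    : Prop :=
  exists (H : S * R -> S) (p : S),
    {within A `*` `[0, 1], continuous H} /\
    forall x, A x -> H (x, 0) = x /\ H (x, 1) = p.

Record graph (D : finType) := Graph {
  gverts : {set D};
  gadj : rel D
}.

Definition is_graph (D : finType) (G : graph D) : Prop :=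
  [/\ symmetric (gadj G), irreflexive (gadj G)
    & forall x y, gadj G x y -> (x \in gverts G) && (y \in gverts G)].

Definition is_subgraph (D : finType) (T G : graph D) : Prop :=
  [/\ is_graph T, gverts T \subset gverts G & subrel (gadj T) (gadj G)].

Definition path_in (D : finType) (G : graph D) (x : D) (p : seq D) : bool :=
  [&& x \in gverts G, path (gadj G) x p & uniq (x :: p)].

Definition cycle_in (D : finType) (G : graph D) (c : seq D) : bool :=
  [&& (2 < size c)%N, cycle (gadj G) c & uniq c].

Definition is_tree (D : finType) (T : graph D) : Prop :=
  [/\ is_graph T,
      {in gverts T &, forall x y, connect (gadj T) x y}
    & forall c, ~~ cycle_in T c].

Definition hamiltonian_cycle (D : finType) (G : graph D) (c : seq D) : Prop :=
  cycle_in G c /\ c =i gverts G.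

(* The simplices are nonempty vertex sets; every element of 'I_n is a vertex. *)
Definition simplicial_complex (n : nat) (K : {set {set 'I_n}}) : Prop :=
  [/\ finset.set0 \notin K,
      forall v : 'I_n, [set v]%SET \in K
    & forall s t : {set 'I_n},
        s \in K -> t \subset s -> t != finset.set0 -> t \in K].

Definition triangles (n : nat) (K : {set {set 'I_n}}) : {set {set 'I_n}} :=
  [set t in K | #|t| == 3%N]%SET.

(* Barycentric coordinates: the standard basis vectors of R^n are the
   vertices. *)
Definition realization (R : realType) (n : nat) (K : {set {set 'I_n}})
    : set 'rV[R]_n :=
  [set x : 'rV[R]_n | [/\ forall i, 0 <= x ord0 i, \sum_i x ord0 i = 1
                        & [set i | x ord0 i != 0%R]%SET \in K]].
Arguments realization R {n} K.

(* A map on S whose faces are the triangles of K: as in any map on a closed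
   surface, each edge is on the boundary of exactly two faces. *)
Definition triangulation (R : realType) (S : topologicalType) (n : nat)
    (K : {set {set 'I_n}}) (h : 'rV[R]_n -> S) : Prop :=
  [/\ simplicial_complex K,
      {in K, forall s : {set 'I_n}, exists2 t, t \in triangles K & s \subset t},
      {in K, forall e : {set 'I_n}, #|e| = 2%N ->
         #|[set t in triangles K | e \subset t]%SET| = 2%N}
    & homeomorphism_on (realization R K) [set: S] h].

Definition equivelar (n : nat) (K : {set {set 'I_n}}) (q : nat) : Prop :=
  forall v : 'I_n, #|[set t in triangles K | v \in t]%SET| = q.

Definition edge_graph (n : nat) (K : {set {set 'I_n}}) : graph 'I_n :=
  Graph [set: 'I_n]%SET
    (fun u v => (u != v) && ([set u; v]%SET \in K)).

(* The vertices and edges of the closed polygon with cyclic vertex sequence c,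
   as a one-dimensional simplicial complex. *)
Definition cycle_complex (n : nat) (c : seq 'I_n) : {set {set 'I_n}} :=
  ([set [set v] | v in c] :|: [set [set v; next c v] | v in c])%SET.

Definition contractible_cycle (R : realType) (S : topologicalType) (n : nat)
    (h : 'rV[R]_n -> S) (c : seq 'I_n) : Prop :=
  null_homotopic_in R (h @` realization R (cycle_complex c)).

(* Combinatorial data of a map: its edge graph, on vertices of type D, and for
   each face, indexed by I, the boundary polygon. *)
Record surface_map (D I : finType) := SurfaceMap {
  map_graph : graph D;
  map_face : I -> graph D
}.

(* The edge of the dual map crossing the edge e of K lies on the boundary of
   the face dual to v exactly when v is an end of e; here e is the
   intersection of the two triangles. *)
Definition dual_map (n : nat) (K : {set {set 'I_n}})
    : surface_map {set 'I_n} 'I_n :=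
  let adj (t1 t2 : {set 'I_n}) :=
    [&& t1 \in triangles K, t2 \in triangles K & #|t1 :&: t2| == 2%N] in
  SurfaceMap (Graph (triangles K) adj)
    (fun v => Graph [set t in triangles K | v \in t]%SET
                (fun t1 t2 => adj t1 t2 && (v \in t1 :&: t2))).

Definition proper_tree (D I : finType) (M : surface_map D I) (n q : nat)
    (T : graph D) : Prop :=
  [/\ is_subgraph T (map_graph M), is_tree T, #|gverts T| = (n - 2)%N,
      forall (F : I) (u1 u2 : D),
        u1 \in gverts T -> u2 \in gverts T ->
        u1 \in gverts (map_face M F) -> u2 \in gverts (map_face M F) ->
        exists p : seq D,
          [/\ path_in T u1 p, path_in (map_face M F) u1 p & last u1 p = u2]
    & forall (F : I) (u : D) (p : seq D),
        path_in T u p -> path_in (map_face M F) u p -> (size p <= q - 2)%N].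

(* Main.v *)
(* From a proper tree, build a stacked disk: growing the tree from a root, each
   new triangle t is glued to its parent p along an edge, and its third vertex w
   is new, since by condition (1) an earlier triangle containing w would be
   joined to t by a path avoiding p, which closes a cycle in the tree. Hence
   n - 2 triangles cover n vertices, all on the boundary cycle, and the disk
   collapses to a point triangle by triangle.

   Conversely, a null-homotopic cycle c has trivial holonomy under every flat
   transport on the complex, by a fine grid on the homotopy. By linear duality
   over F_2, the lift of c at level 0 to the double cover given by any cocycle z
   vanishing on c is then the mod 2 boundary of a set of lifted triangles. For
   z = 0 this splits the triangles into two sides, whose dual graphs are
   connected because every vertex is on c. If both dual graphs had a cycle, let z
   count the crossings of these two cycles. The boundary coefficient of a lifted
   triangle then depends on its side and level only (all vertices are on c), and
   not on the level, since each side has an edge with z = 1. But it must jump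
   across c at level 0 and not at level 1, a contradiction. So some side has a
   tree as dual graph. *)

Require Import Defs.
From mathcomp Require Import all_boot all_order all_algebra.
From mathcomp Require Import boolp.

Set Implicit Arguments.
Unset Strict Implicit.
Unset Printing Implicit Defensive.
Import Order.TTheory GRing.Theory Num.Theory.

Local Open Scope set_scope.

(** * Finite graphs and cyclic lists *)

Lemma connect_crossing (T : finType) (e : rel T) (U : {set T}) (x y : T) :
  connect e x y -> x \in U -> y \notin U ->
  exists a b, [/\ e a b, a \in U & b \notin U].
Proof.
case/connectP=> p; elim: p x => [|z p IHp] x /=; first by move=> _ -> ->.
case/andP=> exz pz lastp xU yU; have [zU|zU] := boolP (z \in U).
  exact: IHp lastp zU yU.
by exists x, z.
Qed.

Lemma next_next_neq (T : eqType) (c : seq T) (x : T) :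
  uniq c -> 2 < size c -> x \in c -> next c (next c x) != x.
Proof.
move=> Uc sc xc; have [i s cE] := rot_to xc.
have Us : uniq (x :: s) by rewrite -cE rot_uniq.
have : 2 < size (x :: s) by rewrite -cE size_rot.
rewrite -(next_rot i Uc x) -(next_rot i Uc) cE.
case: s {cE} Us => [|y [|z s]] //= /andP[]; rewrite !inE !negb_or.
move=> /and3P[xy xz _] _ _.
by rewrite eqxx [y == x]eq_sym (negPf xy) eqxx eq_sym.
Qed.

(** Two positions with the same edge would be successors of each other, which a cycle of length at
    least 3 excludes. *)
Lemma next_edge_inj (T : finType) (c : seq T) :
  uniq c -> 2 < size c ->
  {in c &, forall x y, [set x; next c x] = [set y; next c y] -> x = y}.
Proof.
move=> Uc sc x y xc yc /setP E.
have /esym := E x; rewrite !inE eqxx /= => /orP[/eqP//|/eqP xE].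
have := E y; rewrite !inE eqxx /= => /orP[/eqP//|/eqP yE].
by have := next_next_neq Uc sc xc; rewrite -yE -xE eqxx.
Qed.

Lemma next_at_neq_last (T : eqType) (x y y1 y2 : T) (s : seq T) :
  x != last y s -> next_at x y1 y s = next_at x y2 y s.
Proof.
by elim: s y => [|z s IHs] y /=; [move/negPf-> | case: ifP => // _ /IHs].
Qed.

Lemma next_at_last (T : eqType) (y x : T) (s : seq T) :
  uniq (x :: s) -> next_at (last x s) y x s = y.
Proof.
elim: s x => [|z s IHs] x /=; first by rewrite eqxx.
case/andP=> xs Us; rewrite IHs //; case: eqP => // lastE.
by rewrite -lastE mem_last in xs.
Qed.

Lemma next_last (T : eqType) (x : T) (s : seq T) :
  uniq (x :: s) -> next (x :: s) (last x s) = x.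
Proof. exact: next_at_last. Qed.

Lemma cards3_eq (T : finType) (t : {set T}) : #|t| = 3 ->
  exists a b d, [/\ a != b, a != d, b != d & t = [set a; b; d]].
Proof.
move=> t3; have /card_gt0P[a at_] : 0 < #|t| by rewrite t3.
have : #|t :\ a| == 2 by have := cardsD1 a t; rewrite at_ t3 => -[->].
case/cards2P=> b [d [nbd E]]; have := setD1K at_; rewrite E setUA => <-.
have : a \notin t :\ a by rewrite !inE eqxx.
by rewrite E !inE negb_or => /andP[nab nad]; exists a, b, d.
Qed.

(** * Stacked disks built from trees, and their boundary cycles *)

Section Triangles.
Variables (V : finType) (tri : {set {set V}}).

Definition tri_adj (t t' : {set V}) :=
  [&& t \in tri, t' \in tri & #|t :&: t'| == 2].

Hypothesis tri3 : {in tri, forall t : {set V}, #|t| = 3}.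
Hypothesis edge2 : forall (e t : {set V}), #|e| = 2 -> t \in tri -> e \subset t ->
  #|[set s in tri | e \subset s]| = 2.

Lemma tri_adj_sym : symmetric tri_adj.
Proof. by move=> t t'; rewrite /tri_adj setIC andbCA. Qed.

Lemma tri_adj_neq t t' : tri_adj t t' -> t != t'.
Proof.
case/and3P=> tT _ ; apply: contraTneq => <-.
by rewrite setIid tri3.
Qed.

Lemma tri_edgeI (t t' e : {set V}) :
  t \in tri -> t' \in tri -> t != t' -> #|e| = 2 -> e \subset t -> e \subset t' ->
  t :&: t' = e.
Proof.
move=> tT t'T ntt' ce et et'; apply/esym/eqP.
rewrite eqEcard subsetI et et' ce /= leqNgt; apply: contra ntt' => c3.
have tI : t :&: t' = t by apply/eqP; rewrite eqEcard subsetIl tri3.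
have t'I : t :&: t' = t' by apply/eqP; rewrite eqEcard subsetIr tri3.
by rewrite -tI t'I.
Qed.

Lemma edge_tri_adj (t t' e : {set V}) :
  t \in tri -> t' \in tri -> t != t' -> #|e| = 2 -> e \subset t -> e \subset t' ->
  tri_adj t t'.
Proof.
move=> tT t'T ntt' ce et et'.
by rewrite /tri_adj tT t'T (tri_edgeI tT t'T ntt' ce et et') ce.
Qed.

Lemma edge_trisE (t t' e : {set V}) :
  t \in tri -> t' \in tri -> t != t' -> #|e| = 2 -> e \subset t -> e \subset t' ->
  [set s in tri | e \subset s] = [set t; t'].
Proof.
move=> tT t'T ntt' ce et et'; apply/esym/eqP; rewrite eqEcard.
rewrite (edge2 ce tT et) cards2 ntt' andbT.
by apply/subsetP=> s; rewrite !inE => /orP[]/eqP->; rewrite ?tT ?t'T.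
Qed.

Lemma edge_other (e t : {set V}) : #|e| = 2 -> t \in tri -> e \subset t ->
  exists t' : {set V}, [/\ t' \in tri, t' != t & e \subset t'].
Proof.
move=> ce tT et; have := edge2 ce tT et => /eqP/cards2P[a [b [nab E]]].
have mE s : (s \in tri) && (e \subset s) = (s == a) || (s == b).
  by move/setP: E => /(_ s); rewrite !inE.
have := mE t; have /andP[aT ea] : (a \in tri) && (e \subset a) by rewrite mE eqxx.
have /andP[bT eb] : (b \in tri) && (e \subset b) by rewrite mE eqxx orbT.
rewrite tT et => /esym/orP[]/eqP->; first by exists b; split=> //; rewrite eq_sym.
by exists a.
Qed.

Lemma edge_tris2 (t t' s : {set V}) :
  tri_adj t t' -> s \in tri -> t :&: t' \subset s -> s = t \/ s = t'.
Proof.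
move=> a sT es; have ntt' := tri_adj_neq a; case/and3P: a => tT t'T /eqP ce.
have := edge_trisE tT t'T ntt' ce (subsetIl _ _) (subsetIr _ _).
move=> /setP/(_ s); rewrite !inE sT es /= => /esym/orP[]/eqP; by [left|right].
Qed.

(** A stacked disk. The condition in [stackedU] makes the vertex of [t] off [p] new, so gluing [t]
    is an elementary expansion along the edge shared with [p]. *)
Inductive stacked : {set {set V}} -> Prop :=
| stacked1 (t : {set V}) : #|t| = 3 -> stacked [set t]
| stackedU (U : {set {set V}}) (t p : {set V}) :
    stacked U -> p \in U -> #|t| = 3 -> #|t :&: p| = 2 ->
    (forall v, v \in t -> v \notin p -> v \notin cover U) -> stacked (t |: U).

(** A simple path from [p] to [t] that avoids the edge has length at least 2, so adding the edge
    closes it to a cycle. *)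
Lemma tree_bridge (T : finType) (G : graph T) (p t : T) :
  is_tree G -> gadj G p t ->
  ~~ connect (fun x y => gadj G x y && ([set x; y] != [set p; t])) p t.
Proof.
case=> [[Gsym Girr Gv] _ acyc] apt; apply/negP => /connectP[s0 ps0 lasts0].
case/shortenP: ps0 lasts0 => s ps Us _ lasts.
have npt : p != t by apply: contraTneq apt => ->; rewrite Girr.
have := acyc (p :: s); rewrite /cycle_in Us andbT negb_and /= rcons_path.
rewrite (sub_path _ ps) /=; last by move=> x y /andP[].
rewrite -lasts Gsym apt orbF.
case: s ps lasts {Us} => [|a [|b s]] //= ps lasts.
  by rewrite lasts eqxx in npt.
by move: ps; rewrite -lasts eqxx /= !andbF.
Qed.

(** The disk grows as a stacked set [U] that is connected within itself. The last hypothesis is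
    condition (1) of proper trees in terms of connectivity. *)
Lemma tree_stacked (G : graph {set V}) :
  is_tree G -> gverts G != set0 -> gverts G \subset tri ->
  subrel (gadj G) tri_adj ->
  (forall v t t', t \in gverts G -> t' \in gverts G -> v \in t -> v \in t' ->
     connect (fun a b => gadj G a b && (v \in a :&: b)) t t') ->
  stacked (gverts G).
Proof.
move=> Gtree; case: (Gtree) => [[Gsym Girr Gv] Gconn acyc].
move=> /set0Pn[r rG] /subsetP GT Gadj Gface.
pose rU (U : {set {set V}}) := [rel a b | [&& a \in U, b \in U & gadj G a b]].
have rUsym U : symmetric (rU U) by move=> a b /=; rewrite Gsym andbCA.
suff grow m : m < #|gverts G| -> exists U : {set {set V}},
    [/\ U \subset gverts G, #|U| = m.+1, stacked U
      & {in U &, forall a b, connect (rU U) a b}].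
  have gt0 : 0 < #|gverts G| by apply/card_gt0P; exists r.
  have [|U [UG cU sU _]] := grow #|gverts G|.-1; first by rewrite prednK.
  have /eqP <- // : U == gverts G by rewrite eqEcard UG cU prednK /=.
elim: m => [|m IHm] lm.
  exists [set r]; split; rewrite ?sub1set ?cards1 //.
  - by apply: stacked1; rewrite tri3 ?GT.
  - by move=> a b; rewrite !inE => /eqP-> /eqP->; apply: connect0.
have [U [UG cU sU Uconn]] := IHm (ltnW lm).
have [x xU] : exists x, x \in U by apply/card_gt0P; rewrite cU.
have [y yG yU] : exists2 y, y \in gverts G & y \notin U.
  apply/subsetPn; apply: contraTN lm => /subset_leq_card.
  by rewrite cU -leqNgt.
have [p [t [apt pU tU]]] :=
  connect_crossing (Gconn _ _ (subsetP UG _ xU) yG) xU yU.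
have [pG tG] := andP (Gv _ _ apt).
exists (t |: U); split.
- by rewrite subUset sub1set tG.
- by rewrite cardsU1 tU cU.
- have aptT := Gadj _ _ apt.
  have t3 : #|t| = 3 by rewrite tri3 ?GT.
  apply: (stackedU sU pU t3).
    by move: aptT => /and3P[_ _ /eqP]; rewrite setIC.
  move=> w wt wp; apply/negP => /bigcupP[t' t'U wt'].
  (* If [w] were in a triangle [t'] of [U], then [p] would be joined to [t'] inside [U], hence away
     from [t], and [t'] to [t] through triangles containing [w], hence away from [p]. *)
  case/negP: (tree_bridge Gtree apt); apply: (@connect_trans _ _ t').
    apply: (connect_sub _ (Uconn _ _ pU t'U)) => a b /and3P[aU bU ab].
    apply: connect1; rewrite ab; apply: contraNneq tU => /setP/(_ t).
    by rewrite !inE eqxx orbT => /orP[]/eqP->.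
  have t'G := subsetP UG _ t'U.
  apply: (connect_sub _ (Gface w t' t t'G tG wt' wt)) => a b /andP[ab wab].
  apply: connect1; rewrite ab; apply: contraNneq wp => /setP/(_ p).
  by move: wab; rewrite !inE eqxx => /andP[wa wb] /orP[]/eqP->.
- have mono a b : connect (rU U) a b -> connect (rU (t |: U)) a b.
    apply: connect_sub => {}a {}b /and3P[aU bU ab].
    by apply: connect1; rewrite /= !inE aU bU ab !orbT.
  have tp : connect (rU (t |: U)) p t.
    by apply: connect1; rewrite /= !inE pU eqxx apt orbT.
  have sc := sym_connect_sym (rUsym (t |: U)).
  have top a : a \in t |: U -> connect (rU (t |: U)) p a.
    by case/setU1P=> [->//|aU]; apply: mono; apply: Uconn.
  move=> a b aU bU; apply: (@connect_trans _ _ p); last exact: top.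
  by rewrite sc; apply: top.
Qed.

Definition coface (U : {set {set V}}) (a b : V) :=
  [exists t in U, [set a; b] \subset t].

Lemma sub2_set (a b : V) (t : {set V}) :
  ([set a; b] \subset t) = (a \in t) && (b \in t).
Proof. by rewrite subUset !sub1set. Qed.

Lemma card2_sub3 (x y w : V) (e : {set V}) : #|e| = 2 -> e \subset [set w; x; y] ->
  [\/ e = [set x; y], e = [set w; x] | e = [set w; y]].
Proof.
move/eqP/cards2P=> [a [b [nab ->]]]; rewrite sub2_set !inE.
have E : [set b; a] = [set a; b] by rewrite setUC.
by move=> /andP[/orP[/orP[]|]/eqP ? /orP[/orP[]|]/eqP ?]; subst;
  rewrite ?eqxx // in nab *;
  by (idtac + rewrite setUC); (constructor 1 + constructor 2 + constructor 3).
Qed.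

(** Gluing [t] replaces one edge of the boundary cycle by the two edges through the new vertex. The
    last clause is carried along to find the glued edge on the cycle at each stage. *)
Lemma stacked_boundary (U : {set {set V}}) :
  stacked U -> U \subset tri ->
  exists c, [/\ uniq c, size c = #|U|.+2, c =i cover U, cycle (coface U) c
    & forall e : {set V}, #|e| = 2 -> #|[set t in U | e \subset t]| = 1 ->
        exists2 x, x \in c & e = [set x; next c x]].
Proof.
elim=> {U} [t /cards3_eq[a [b [d [nab nad nbd ->]]]] _|
            U t p sU IHU pU t3 tp2 newv] .
  exists [:: a; b; d]; split.
  - by rewrite /= !inE negb_or nab nad nbd.
  - by rewrite cards1.
  - by move=> x; rewrite /cover big_set1 !inE orbA.
  - rewrite /= andbT; apply/and3P; split; apply/existsP; exists [set a; b; d];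
      by rewrite inE eqxx sub2_set !inE !eqxx ?orbT.
  - move=> e e2 e1; have {e1} eU : e \subset [set a; b; d].
      have /card_gt0P[s] : 0 < #|[set t in [set [set a; b; d]] | e \subset t]|.
        by rewrite e1.
      by rewrite !inE => /andP[/eqP->].
    case: (card2_sub3 e2 eU) => ->.
    + exists b; first by rewrite !inE eqxx orbT.
      by rewrite /= [b == a]eq_sym (negPf nab) eqxx.
    + by exists a; rewrite ?inE ?eqxx //= eqxx.
    + exists d; first by rewrite !inE eqxx !orbT.
      by rewrite /= ![d == _]eq_sym (negPf nad) (negPf nbd) eqxx setUC.
rewrite subUset sub1set => /andP[tT UT].
have [c [Uc sc cE cyc bd]] := IHU UT.
have pT : p \in tri := subsetP UT _ pU.
have tp : t != p by apply: contra_eq_neq tp2 => ->; rewrite setIid tri3.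
have tU : t \notin U.
  apply/negP=> tU; move: tp.
  rewrite eqEcard tri3 // tri3 // leqnn andbT => /subsetPn[v vt vp].
  by move: (newv v vt vp); rewrite (subsetP (bigcup_sup _ tU)).
have [x [y [nxy tpE]]] : exists x y, x != y /\ t :&: p = [set x; y].
  by have /eqP/cards2P[x [y [? ?]]] := tp2; exists x, y.
have [w wt wp] : exists2 w, w \in t & w \notin p.
  by apply/subsetPn; apply: contra tp => /setIidPl I; rewrite I t3 in tp2.
have [xt xp] : x \in t /\ x \in p by apply/setIP; rewrite tpE !inE eqxx.
have [yt yp] : y \in t /\ y \in p by apply/setIP; rewrite tpE !inE eqxx orbT.
have nwx : w != x by apply: contraNneq wp => ->.
have nwy : w != y by apply: contraNneq wp => ->.
have tE : t = [set w; x; y].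
  apply/esym/eqP; rewrite eqEcard !subUset !sub1set wt xt yt t3.
  by rewrite -setUA cardsU1 !inE negb_or nwx nwy cards2 nxy.
have wc : w \notin c by rewrite cE newv.
(* The two triangles on this edge are [t] and [p], and [t] is not in [U], so the edge is on the
   boundary of [U]. *)
have pU1 : #|[set s in U | [set x; y] \subset s]| = 1.
  rewrite -(cards1 p); congr #|pred_of_set _|; apply/setP=> s; rewrite !inE.
  apply/andP/eqP=> [[sU']|->]; last by rewrite pU sub2_set xp yp.
  rewrite -tpE => es; have at_p : tri_adj t p by rewrite /tri_adj tT pT tp2.
  have [sE|//] := edge_tris2 at_p (subsetP UT _ sU') es.
  by rewrite -sE sU' in tU.
(* Rotate the cycle until the shared edge is the one that closes it, from the last entry [b] to the
   head [a]; then [w] can simply be put in front. *)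
have [c0 [[Uc0 sc0 c0E cyc0 bd0] hd]] : exists c0, [/\ uniq c0, size c0 = #|U|.+2,
    c0 =i cover U, cycle (coface U) c0
    & forall e : {set V}, #|e| = 2 -> #|[set t in U | e \subset t]| = 1 ->
        exists2 x, x \in c0 & e = [set x; next c0 x]] /\
    exists a b s, [/\ [set a; b] = [set x; y], c0 = a :: s & last a s = b].
  have xy2 : #|[set x; y]| = 2 by rewrite cards2 nxy.
  have [a ac eE] := bd _ xy2 pU1.
  have [i s cE'] := rot_to ac.
  have rE : rot 1 (rot i c) = rcons s a by rewrite cE' rot1_cons.
  have nE : next c a = head a s.
    by rewrite -(next_rot i Uc) cE'; case: (s) => [|z s'] /=; rewrite eqxx.
  have Urot : uniq (rcons s a) by rewrite -rE !rot_uniq.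
  exists (rcons s a); split; first split=> //.
  - by rewrite -rE !size_rot.
  - by move=> z; rewrite -rE !mem_rot cE.
  - by rewrite -rE !rot_cycle.
  - move=> e e2 /(bd e e2)[z zc ze]; exists z; first by rewrite -rE !mem_rot.
    by rewrite -rE !next_rot ?rot_uniq.
  - case: s cE' nE {rE Urot} => [cE' _|z s _ nE].
      by have := size_rot i c; rewrite cE' sc.
    by exists z, a, (rcons s a); rewrite last_rcons eE nE setUC.
move: hd => [a [b [s [abE c0s lasts]]]].
have abI : t :&: p = [set a; b] by rewrite abE.
have [aI bI] : a \in t :&: p /\ b \in t :&: p by rewrite abI !inE !eqxx orbT.
have [[at_ ap] [bt bp]] := (setIP aI, setIP bI).
have tabE : t = [set w; a; b] by rewrite tE -!setUA abE.
have coverE z : z \in cover (t |: U) = (z \in t) || (z \in cover U).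
  by rewrite /cover bigcup_setU big_set1 inE.
have pcov z : z \in p -> z \in cover U by apply/subsetP/bigcup_sup.
exists (w :: c0); rewrite c0s in c0E sc0 Uc0 cyc0 bd0 *; split.
- by rewrite cons_uniq Uc0 c0E -cE wc.
- by rewrite /= cardsU1 tU -sc0.
- move=> z; rewrite inE c0E coverE tabE !inE.
  case: eqP => //= _; case: eqP => [->|_]; first by rewrite pcov.
  by case: eqP => [->|//]; rewrite pcov.
- have cU' u v : coface U u v -> coface (t |: U) u v.
    by case/existsP=> r /andP[rU uvr]; apply/existsP; exists r; rewrite inE rU orbT.
  have ct u v : u \in t -> v \in t -> coface (t |: U) u v.
    by move=> ut vt; apply/existsP; exists t; rewrite setU11 sub2_set ut.
  move: cyc0; rewrite /= !rcons_path => /andP[pas _].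
  by rewrite (sub_path cU' pas) lasts !ct.
(* An edge of [t] is either [ab], which lies in both [t] and [p], or one of the two new edges at
   [w]. Any other edge is an old boundary edge distinct from [ab], so its successor is unchanged. *)
- move=> e e2 e1; have [et|net] := boolP (e \subset t).
    move: (et); rewrite tabE => /(card2_sub3 e2)[] eE.
    + suff : 1 < #|[set r in t |: U | e \subset r]| by rewrite e1.
      rewrite -(_ : #|[set t; p]| = 2); last by rewrite cards2 tp.
      apply/subset_leq_card/subsetP=> r; rewrite !inE => /orP[]/eqP->.
        by rewrite eqxx et.
      by rewrite pU orbT eE sub2_set ap bp.
    + by exists w; rewrite ?mem_head //= eqxx.
    + exists b; first by rewrite inE -lasts mem_last orbT.
      have -> : b = last w (a :: s) by rewrite /= lasts.
      by rewrite next_last ?cons_uniq ?Uc0 ?c0E -?cE ?wc //= lasts setUC eE.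
  have [z zc eE] : exists2 z, z \in a :: s & e = [set z; next (a :: s) z].
    apply: bd0 => //; rewrite -[RHS]e1; congr #|pred_of_set _|; apply/setP=> r.
    by rewrite !inE; case: eqP => [->|//]; rewrite (negPf net) !andbF.
  exists z; first by rewrite inE zc orbT.
  have nzb : z != last a s.
    apply: contraNneq net => zE; rewrite eE zE next_last // sub2_set lasts.
    by rewrite at_ bt.
  have nzw : z != w by apply: contraNneq wc => <-; rewrite cE -c0E.
  by rewrite eE /= (negPf nzw) (next_at_neq_last w a nzb).
Qed.

End Triangles.

(* In the following, bool is the field with two elements. *)
Local Open Scope ring_scope.

(** * Linear duality, and transport along vertex paths *)

Lemma big_enum_rank (R : Type) (idx : R) (op : Monoid.com_law idx) (I : finType)
    (F : 'I_#|I| -> R) :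
  \big[op/idx]_(i < #|I|) F i = \big[op/idx]_i F (enum_rank i).
Proof. by apply: reindex; apply: onW_bij; apply: enum_rank_bij. Qed.

(** The Fredholm alternative: either [chi] is in the row space of the transposed matrix, or some
    column of the cokernel pairs with it to a nonzero scalar, which is then normalised to 1. *)
Lemma solvable_or_dual (F : fieldType) (I J : finType) (M : I -> J -> F)
    (chi : I -> F) :
  (exists f : J -> F, forall i, \sum_j M i j * f j = chi i) \/
  (exists w : I -> F, (forall j, \sum_i w i * M i j = 0)
     /\ \sum_i w i * chi i = 1).
Proof.
pose A := \matrix_(j < #|J|, i < #|I|) M (enum_val i) (enum_val j).
pose r := \row_(i < #|I|) chi (enum_val i).
have [/submxP[D rE]|rA] := boolP (r <= A)%MS; [left|right].
  exists (fun j => D ord0 (enum_rank j)) => i.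
  have /rowP/(_ (enum_rank i)) := rE; rewrite !mxE enum_rankK big_enum_rank /= => ->.
  by apply: eq_bigr => j _; rewrite !mxE !enum_rankK mulrC.
have [k rk] : exists k, (r *m cokermx A) ord0 k != 0.
  apply/existsP; apply: contraNT rA => /existsPn rk0; rewrite submxE.
  apply/eqP/rowP=> k; apply/eqP; rewrite [X in _ == X]mxE.
  by have := rk0 k; rewrite negbK.
set s := (r *m _) ord0 k in rk.
exists (fun i => s^-1 * cokermx A (enum_rank i) k); split=> [j|].
  under eq_bigr do rewrite -mulrA; rewrite -mulr_sumr.
  have /matrixP/(_ (enum_rank j) k) := mulmx_coker A; rewrite !mxE big_enum_rank.
  have -> : \sum_i A (enum_rank j) (enum_rank i) * cokermx A (enum_rank i) k =
      \sum_i cokermx A (enum_rank i) k * M i j.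
    by apply: eq_bigr => i _; rewrite mulrC [A _ _]mxE !enum_rankK.
  by move=> ->; rewrite mulr0.
under eq_bigr do rewrite -mulrA; rewrite -mulr_sumr -(mulVf rk).
congr (_ * _); rewrite /s mxE big_enum_rank.
by apply: eq_bigr => i _; rewrite mulrC [r _ _]mxE enum_rankK.
Qed.

Lemma pair_sum (R : nmodType) (I J : finType) (G : I * J -> R) :
  \sum_p G p = \sum_i \sum_j G (i, j).
Proof. by rewrite pair_bigA; apply: eq_bigr => -[]. Qed.

Lemma big_next (R : Type) (idx : R) (op : Monoid.com_law idx) (T : eqType)
    (d : seq T) (F : T -> R) :
  uniq d -> \big[op/idx]_(x <- d) F (next d x) = \big[op/idx]_(x <- d) F x.
Proof.
move=> Ud; rewrite -(big_map (next d) xpredT F); apply: perm_big.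
have Um : uniq [seq next d i | i <- d].
  by rewrite map_inj_in_uniq // => x y _ _; apply/can_inj/prev_next.
apply: uniq_perm => //; apply: (uniq_min_size Um _ _).2.
  by move=> _ /mapP[x xd ->]; rewrite mem_next.
by rewrite size_map.
Qed.

Section Transport.
Variables (V X : Type) (tau : V -> V -> X -> X).

Fixpoint transport (x : V) (p : seq V) (a : X) : X :=
  if p is y :: p' then transport y p' (tau x y a) else a.

Lemma transport_cat x p q a :
  transport x (p ++ q) a = transport (last x p) q (transport x p a).
Proof. by elim: p x a => [|y p IHp] x a //=. Qed.

End Transport.

(** A local system with fibre [X]. Since [u], [v], [w] may coincide, [tau v u] inverts [tau u v] on
    a common simplex. *)
Definition flat_transport (V : finType) (K : {set {set V}}) (X : Type)
    (tau : V -> V -> X -> X) :=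
  (forall u a, tau u u a = a) /\
  (forall s, s \in K -> forall u v w a, u \in s -> v \in s -> w \in s ->
     tau v w (tau u v a) = tau u w a).

(** * The two sides of a Hamiltonian cycle with trivial holonomy *)

Section Filling.
Variables (V : finType) (tri : {set {set V}}).
Hypothesis tri3 : {in tri, forall t : {set V}, #|t| = 3%N}.
Hypothesis edge2 : forall (e t : {set V}), #|e| = 2%N -> t \in tri -> e \subset t ->
  #|[set s in tri | e \subset s]| = 2%N.
Variable c : seq V.
Hypothesis Uc : uniq c.
Hypothesis sc : (2 < size c)%N.
Hypothesis cV : forall v, v \in c.
Hypothesis ctri : cycle (coface tri) c.
(** The combinatorial form in which null-homotopy of [c] enters: trivial holonomy in every local
    system. *)
Hypothesis holonomy1 : forall (X : Type) (tau : V -> V -> X -> X),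
  flat_transport tri tau -> forall x p, c = x :: p ->
  forall a, transport tau x (rcons p x) a = a.

Lemma next_neq x : x != next c x.
Proof.
by apply/eqP=> E; have := next_next_neq Uc sc (cV x); rewrite -!E eqxx.
Qed.

Definition cycle_edges : {set {set V}} := [set [set x; next c x] | x in c].

Lemma sum_edges3 (F : {set V} -> bool) (u v w : V) :
  u != v -> v != w -> u != w ->
  \sum_(e : {set V} | (#|e| == 2%N) && (e \subset [set u; v; w])) F e
    = F [set u; v] + F [set v; w] + F [set u; w].
Proof.
move=> uv vw uw.
have E (e : {set V}) : (#|e| == 2%N) && (e \subset [set u; v; w]) =
    (e \in [set u; v] |: ([set v; w] |: [set [set u; w]])).
  rewrite !inE; apply/idP/idP=> [/andP[/eqP e2 /(card2_sub3 e2)[]->]|].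
  - by rewrite eqxx orbT.
  - by rewrite eqxx.
  - by rewrite eqxx !orbT.
  - by case/or3P=> /eqP->; rewrite cards2 ?uv ?vw ?uw sub2_set !inE !eqxx !orbT.
have n1 : [set u; v] != [set v; w].
  by apply: contraNneq uw => /setP/(_ u); rewrite !inE eqxx (negPf uv).
have n2 : [set u; v] != [set u; w].
  by apply: contraNneq vw => /setP/(_ v); rewrite !inE eqxx orbT eq_sym (negPf uv).
have n3 : [set v; w] != [set u; w].
  by apply: contraNneq uv => /setP/(_ u); rewrite !inE eqxx (negPf uw) orbF.
rewrite (eq_bigl _ _ E) big_setU1 ?big_setU1 ?big_set1 ?addrA //= ?inE //.
  by rewrite addrA.
by rewrite negb_or n1.
Qed.

Section Cover.
(** [z] describes a double cover with vertices (u, a), whose edges join (u, a) to (v, a + z u v). *)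
Variable z : V -> V -> bool.
Hypothesis z_diag : forall u, z u u = 0.
Hypothesis z_cocycle : forall t u v w, t \in tri -> u \in t -> v \in t -> w \in t ->
  z u v + z v w = z u w.
Hypothesis z_cycle : forall x, z x (next c x) = 0.

(** [phi] is a 2-chain on the double cover: the first clause makes its value independent of the
    vertex through which a lifted triangle is named, the second says that its boundary is the lift
    of [c] at level 0. *)
Lemma filling : exists phi : {set V} -> V -> bool -> bool,
  (forall t u v a, t \in tri -> u \in t -> v \in t ->
     phi t v (a + z u v) = phi t u a) /\
  (forall t t' u a, tri_adj tri t t' -> u \in t :&: t' ->
     phi t u a + phi t' u a = (t :&: t' \in cycle_edges) && ~~ a).
Proof.
have v0 : V by case: (c) sc => [|x s] // _.
pose base (s : {set V}) := odflt v0 [pick x in s].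
have base_in (s : {set V}) x : x \in s -> base s \in s.
  by rewrite /base; case: pickP => //= s0; rewrite s0.
have zsym t u v : t \in tri -> u \in t -> v \in t -> z u v = z v u.
  move=> tT ut vt; have := z_cocycle tT ut vt ut; rewrite z_diag.
  by case: (z u v); case: (z v u).
have zedge x u b : u \in [set x; next c x] -> b \in [set x; next c x] -> z u b = 0.
  have /existsP[t /andP[tT]] := next_cycle ctri (cV x).
  rewrite sub2_set => /andP[xt nt].
  rewrite !inE => /orP[]/eqP-> /orP[]/eqP->; rewrite ?z_diag //.
  by rewrite (zsym t) // z_cycle.
(* (s, a) stands for the lift of the simplex s whose vertex over base s is at
   level a, so phi t u a is the coefficient of the lift of t through (u, a). *)
pose I := ({set V} * bool)%type.
pose M (i j : I) : bool := [&& #|i.1| == 2%N, j.1 \in tri, i.1 \subset j.1 &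
  j.2 == i.2 + z (base i.1) (base j.1)].
pose chi (i : I) : bool := (i.1 \in cycle_edges) && ~~ i.2.
have [[f fM]|[w [wM wchi]]] := solvable_or_dual M chi.
  exists (fun t u a => f (t, a + z u (base t))); split=> [t u v a tT ut vt|].
    by rewrite -addrA (z_cocycle tT ut vt) // (base_in _ u).
  move=> t t' u a at_t' ue; have ntt' := tri_adj_neq tri3 at_t'.
  have /and3P[tT t'T /eqP e2] := at_t'.
  set e := t :&: t' in e2 ue *; have := fM (e, a + z u (base e)).
  have [ut ut'] := setIP ue; have be := base_in _ _ ue; have [bt bt'] := setIP be.
  rewrite /chi /= => fE.
  (* Since [z] vanishes on the edges of [c], the level of a lifted edge of [c] is the same at both
     ends, so it may be read at [base e]. *)
  have -> : (e \in cycle_edges) && ~~ a = (e \in cycle_edges) && ~~ (a + z u (base e)).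
    case eC: (e \in cycle_edges) => //=; case/imsetP: eC ue be => x _ eE.
    by rewrite eE => ux bx; rewrite (zedge x) ?addr0.
  rewrite -fE pair_sum.
  (* Exactly one of the two lifts of a triangle on [e] contains the given lift of [e]. *)
  have term s : \sum_b M (e, a + z u (base e)) (s, b) * f (s, b) =
      if (s == t) || (s == t') then f (s, a + z u (base s)) else 0.
    rewrite /M /= e2 eqxx /=.
    have mE : (s \in tri) && (e \subset s) = (s == t) || (s == t').
      have := edge_trisE edge2 tT t'T ntt' e2 (subsetIl _ _) (subsetIr _ _).
      by move=> /setP/(_ s); rewrite !inE.
    rewrite -mE; case: ifP => [/andP[sT es]|sE]; last first.
      by rewrite big1 // => b _; rewrite andbA sE mul0r.
    rewrite sT es; have [us bs] := (subsetP es _ ue, subsetP es _ be).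
    rewrite big_bool /= -addrA (z_cocycle sT us bs) ?(base_in _ u) //.
    by case: (a + _); rewrite ?mul1r ?mul0r ?addr0 ?add0r.
  rewrite (eq_bigr _ (fun s _ => term s)) -big_mkcond /=.
  rewrite (eq_bigl (mem [set t; t'])); last by move=> s; rewrite !inE.
  by rewrite big_setU1 ?inE // big_set1.
(* A dual solution w is a cocycle on the double cover which is 1 on the lift of
   c at level 0; its 4-sheeted cover contradicts holonomy1. *)
pose tau u v (p : bool * bool) := if u == v then p else
  (p.1 + z u v, p.2 + w ([set u; v], p.1 + z u (base [set u; v]))).
have tau_flat : flat_transport tri tau.
  split=> [u p|t tT u v x [a b] ut vt xt]; first by rewrite /tau eqxx.
  rewrite /tau; have [->//|uv] := eqVneq u v; have [<-|vx] /= := eqVneq v x.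
    by rewrite (negPf uv).
  have zc (r s q : V) := @z_cocycle t r s q tT.
  have buv : base [set u; v] \in [set u; v] by apply: (base_in _ u); exact: set21.
  have bvx : base [set v; x] \in [set v; x] by apply: (base_in _ v); exact: set21.
  have bux : base [set u; x] \in [set u; x] by apply: (base_in _ u); exact: set21.
  have st (r s q : V) : r \in t -> s \in t -> q \in [set r; s] -> q \in t.
    by move=> rt st; rewrite !inE => /orP[]/eqP->.
  (* The path u, v, u runs twice through the same lifted edge, and the two values of [w] cancel. *)
  have [ux|ux] := eqVneq u x.
    rewrite -ux in xt vx bvx *.
    rewrite setUC [base [set v; u]](congr1 base (setUC _ _)).
    rewrite -!addrA (zc _ _ _ ut vt ut) z_diag addr0.
    rewrite (zc _ _ _ ut vt) ?(st _ _ _ ut vt) //.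
    by case: (w _); rewrite ?addr0.
  congr pair; first by rewrite -addrA zc.
  have tE : t = [set u; v; x].
    apply/esym/eqP; rewrite eqEcard !subUset !sub1set ut vt xt tri3 //.
    by rewrite -setUA cardsU1 !inE negb_or uv ux cards2 vx.
  have := wM (t, a + z u (base t)).
  rewrite pair_sum.
  have term e : \sum_a' w (e, a') * M (e, a') (t, a + z u (base t)) =
      if (#|e| == 2%N) && (e \subset t) then w (e, a + z u (base e)) else 0.
    rewrite /M /= tT /=; case: ifP => [/andP[/eqP e2 et]|ne]; last first.
      by rewrite big1 // => a' _; rewrite andbA ne mulr0.
    have bet : base e \in t.
      have /card_gt0P[y ye] : (0 < #|e|)%N by rewrite e2.
      by apply: (subsetP et); apply: base_in ye.
    have btt : base t \in t by apply: base_in ut.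
    rewrite e2 et /= big_bool -(zc u (base e) (base t)) // addrA.
    by case: (a + _); case: (z (base e) (base t));
      rewrite /= ?mulr1 ?mulr0 ?addr0 ?add0r.
  rewrite (eq_bigr _ (fun s _ => term s)) -big_mkcond /= tE sum_edges3 //.
  rewrite -[a + z u v + _]addrA (zc _ _ _ ut vt) ?(st _ _ _ vt xt) //.
  by do 3 case: (w _); case: b.
have [x0 [p cE]] : exists x p, c = x :: p.
  by case: (c) sc => [|x p] // _; exists x, p.
have := holonomy1 tau_flat cE (false, false).
(* As [z] vanishes on [c], the lift from level 0 stays there and the second coordinate collects [w]
   along it. The total is the pairing of [w] with [chi], which is 1. *)
have hol q y b : path (frel (next c)) y q -> transport tau y q (false, b) =
    (false, b + \sum_(x <- belast y q) w ([set x; next c x], false)).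
  elim: q y b => [|y' q IHq] y b /=; first by rewrite big_nil addr0.
  case/andP=> /eqP yy' qp; rewrite /tau ifN; last by rewrite -yy' next_neq.
  have zy : z y y' = 0 by rewrite -yy'.
  rewrite /= zy addr0 IHq // big_cons addrA -yy' add0r.
  by rewrite (zedge y) ?set21 // (base_in _ y) ?set21.
rewrite hol; last first.
  by move: (next c) (cycle_next Uc) => g; rewrite cE.
rewrite belast_rcons -cE add0r => -[]; move: wchi.
rewrite pair_sum.
rewrite (eq_bigr (fun e => if e \in cycle_edges then w (e, false) else 0)) => [|e _].
  rewrite -big_mkcond /= big_imset /=; last by move=> x y _ _; apply: next_edge_inj.
  by rewrite -big_uniq //= => ->.
rewrite big_bool /chi /= andbT andbF mulr0 add0r.
by case: ifP; rewrite ?mulr1 ?mulr0.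
Qed.
End Cover.

Hypothesis star_connected : forall (v : V) (t t' : {set V}),
  t \in tri -> t' \in tri -> v \in t -> v \in t' ->
  connect (fun a b => tri_adj tri a b && (v \in a :&: b)) t t'.

Lemma next_cycle_ind (P : V -> Prop) x y :
  P x -> (forall v, P v -> P (next c v)) -> P y.
Proof.
move=> Px Pn; have : fconnect (next c) x y.
  by rewrite (fconnect_cycle (cycle_next Uc) (cV x)).
by move/iter_findex <-; elim: (findex _ _ _) => //= n /Pn.
Qed.

(** The mod 2 cochain dual to the closed path [d] of triangles. *)
Definition crossing (d : seq {set V}) (e : {set V}) : bool :=
  \sum_(t <- d) (t :&: next d t == e).

(** Passes from unordered edges to ordered pairs, with value 0 on degenerate pairs, as [filling]
    requires. *)
Lemma edge_cochain_cocycle (zeta : {set V} -> bool) :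
  (forall t, t \in tri ->
     \sum_(e : {set V} | (#|e| == 2%N) && (e \subset t)) zeta e = 0) ->
  forall t u v w, t \in tri -> u \in t -> v \in t -> w \in t ->
  ((u != v) && zeta [set u; v]) + ((v != w) && zeta [set v; w]) =
    (u != w) && zeta [set u; w].
Proof.
move=> zeta0 t u v w tT ut vt wt.
have [->|uv] := eqVneq u v; first by rewrite add0r.
have [<-|vw] := eqVneq v w; first by rewrite uv addr0.
have [<-|uw] /= := eqVneq u w; first by rewrite setUC; case: (zeta _).
have := zeta0 t tT; have <- : [set u; v; w] = t.
  apply/eqP; rewrite eqEcard !subUset !sub1set ut vt wt tri3 //.
  by rewrite -setUA cardsU1 !inE negb_or uv uw cards2 vw.
by rewrite sum_edges3 //; do 3 case: (zeta _).
Qed.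

Section Coloured.
Variable f : {set V} -> bool.
Hypothesis f_adj : forall t t', tri_adj tri t t' ->
  f t + f t' = (t :&: t' \in cycle_edges).

(** By [f_adj], adjacent triangles of one colour share an edge off [c]: these are the dual graphs of
    the two parts into which [c] cuts the surface. *)
Definition side (i : bool) : graph {set V} :=
  Graph [set t in tri | f t == i]
    (fun t t' => [&& tri_adj tri t t', f t == i & f t' == i]).

(** The edge is in two triangles, which have different colours by [f_adj], hence one of each
    colour. *)
Lemma cycle_edge_side i x : exists t, [/\ t \in tri, f t = i,
  [set x; next c x] \subset t & forall s, s \in tri -> f s = i ->
     [set x; next c x] \subset s -> s = t].
Proof.
have e2 : #|[set x; next c x]| = 2%N by rewrite cards2 next_neq.
have eC : [set x; next c x] \in cycle_edges by apply: imset_f; rewrite cV.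
have same s t : s \in tri -> t \in tri -> f s = f t -> [set x; next c x] \subset s ->
    [set x; next c x] \subset t -> s = t.
  move=> sT tT fst es et; apply/eqP; apply: contraTT eC => nst.
  rewrite -(tri_edgeI tri3 sT tT nst e2 es et).
  rewrite -(f_adj (edge_tri_adj tri3 sT tT nst e2 es et)) fst.
  by case: (f t).
have /existsP[t /andP[tT et]] := next_cycle ctri (cV x).
have [t' [t'T ntt' et']] := edge_other edge2 e2 tT et.
have [<-|nfi] := eqVneq (f t) i.
  by exists t; split=> // s sT fs es; apply: same.
have ft' : f t' = i.
  apply/eqP; apply: contraNT ntt' => nf'i; apply/eqP; apply: same => //.
  by case: (f t) (f t') i nfi nf'i => [] [] [].
by exists t'; split=> // s sT fs es; apply: same; rewrite ?ft'.
Qed.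

(** The two edges of [c] at [v] cut the ring of triangles around [v] into one fan per side, with end
    triangles [t1] and [t2] on side [i]. The proof excludes a component [C] of the fan that misses
    [t1]. *)
Lemma side_fan i v t t' : t \in gverts (side i) -> t' \in gverts (side i) ->
  v \in t -> v \in t' ->
  connect (fun a b => gadj (side i) a b && (v \in a :&: b)) t t'.
Proof.
set r := (fun a b => _).
have rsym : symmetric r.
  by move=> a b; rewrite /r /= tri_adj_sym setIC [(f a == i) && _]andbC.
pose e1 := [set v; next c v]; pose e2 := [set prev c v; next c (prev c v)].
have [t1 [t1T f1 e1t1 u1]] := cycle_edge_side i v; rewrite -/e1 in e1t1 u1.
have [t2 [t2T f2 e2t2 u2]] := cycle_edge_side i (prev c v); rewrite -/e2 in e2t2 u2.
suff to_t1 s : s \in gverts (side i) -> v \in s -> connect r s t1.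
  move=> ts t's vt vt'; apply: connect_trans (to_t1 t ts vt) _.
  by rewrite (sym_connect_sym rsym); apply: to_t1.
rewrite inE => /andP[sT /eqP fs] vs; apply: contraT => nst1.
have ne12 : e1 != e2.
  apply/eqP=> /(next_edge_inj Uc sc (cV _) (cV _)) E.
  by have := next_neq (prev c v); rewrite next_prev // -E eqxx.
have ve1 : v \in e1 by rewrite set21.
have ve2 : v \in e2 by rewrite /e2 next_prev // set22.
have edges_v e : e \in cycle_edges -> v \in e -> e = e1 \/ e = e2.
  case/imsetP=> x _ ->; rewrite !inE => /orP[]/eqP vE; first by left; rewrite /e1 vE.
  by right; rewrite /e2 vE prev_next.
(* Each triangle at v has two edges at v, and each edge at v outside c is in 0
   or 2 triangles of C, so t1 is in C if and only if t2 is. *)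
pose C := [set s' | connect r s s'].
have Cin s' : s' \in C -> [/\ s' \in tri, v \in s' & f s' = i].
  rewrite inE => /connectP[p rp ->].
  elim: p s sT fs vs {nst1 C} rp => //= y p IHp s sT fs vs.
  case/andP=> /andP[/and3P[/and3P[_ yT _] _ /eqP fy]]; rewrite inE => /andP[_ vy].
  exact: IHp.
have Cadj a b : a \in C -> tri_adj tri a b -> v \in a :&: b ->
    a :&: b \notin cycle_edges -> b \in C.
  move=> aC ab vab nc; have [aT va fa] := Cin _ aC.
  have fb : f b = i.
    by have := f_adj ab; rewrite (negPf nc) fa; case: (f b) (i) => [] [].
  move: aC; rewrite !inE => sa; apply: connect_trans sa (connect1 _).
  by rewrite /r /= ab fa fb eqxx vab.
have t1C : t1 \notin C by rewrite inE.
have parity :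
    \sum_(a in C) \sum_(e : {set V} | (#|e| == 2%N) && (e \subset a)) (v \in e) = 0.
  rewrite big1 // => a /Cin[aT va _].
  have [x [y [w [xy xw yw aE]]]] := cards3_eq (tri3 aT).
  rewrite aE sum_edges3 //; move: va; rewrite aE !inE.
  have [yx wx wy] : [/\ y != x, w != x & w != y].
    by rewrite ![_ == x]eq_sym [w == y]eq_sym.
  by case/orP=> [/orP[]|] /eqP->; rewrite !eqxx ?(negPf xy) ?(negPf xw) ?(negPf yw)
    ?(negPf yx) ?(negPf wx) ?(negPf wy).
rewrite (exchange_big_dep (fun e : {set V} => #|e| == 2%N)) /= in parity; last first.
  by move=> a e _ /andP[].
have e2C : #|e2| = 2%N by rewrite cards2 next_neq.
rewrite (bigD1 e2) /= ?e2C // [X in _ + X]big1 ?addr0 in parity; last first.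
  move=> e /andP[/eqP ec ne2]; have [ve|ve] := boolP (v \in e); last by rewrite big1.
  have [->|ne1] := eqVneq e e1.
    apply: big1 => a /and3P[aC _ ea]; have [aT _ fa] := Cin _ aC.
    by rewrite (u1 a aT fa ea) (negPf t1C) in aC.
  have [a /andP[aC ea]|none] := pickP (fun a => (a \in C) && (e \subset a)); last first.
    by apply: big_pred0 => a; rewrite ec eqxx none.
  have [aT _ _] := Cin _ aC.
  have [b [bT nba eb]] := edge_other edge2 ec aT ea.
  have abE : a :&: b = e by apply: (tri_edgeI tri3) => //; rewrite eq_sym.
  have bC : b \in C.
    apply: (Cadj a) => //; rewrite ?abE //.
      by apply: (edge_tri_adj tri3 aT bT _ ec) => //; rewrite eq_sym.
    by apply/negP=> /edges_v[] // /eqP; apply/negP.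
  have nab : a != b by rewrite eq_sym.
  have abT := edge_trisE edge2 aT bT nab ec ea eb.
  rewrite (eq_bigl (mem [set a; b])) => [|d]; last first.
    rewrite ec eqxx /=; apply/andP/idP=> [[/Cin[dT _ _] ed]|].
      by rewrite -abT inE dT.
    by rewrite in_set2 => /orP[]/eqP->.
  by rewrite big_setU1 ?in_set1 // big_set1.
have t2C : t2 \notin C.
  apply/negP=> t2C; move: parity.
  rewrite (eq_bigl (pred1 t2)) ?big_pred1_eq ?ve2 // => a.
  rewrite /= ?e2C ?eqxx /=; apply/andP/eqP=> [[aC ea]|->//].
  by have [aT _ fa] := Cin _ aC; apply: u2.
(* A path in the star from [s] to [t1] must leave [C]. It cannot do so across an edge off [c], by
   [Cadj], and the only triangles of colour [i] on [e1] and [e2] are [t1] and [t2], both outside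
   [C]. *)
have sC : s \in C by rewrite inE connect0.
have vt1 := subsetP e1t1 _ ve1.
have [a [b [/andP[ab vab] aC bC]]] :=
  connect_crossing (star_connected sT t1T vs vt1) sC t1C.
have [abC|abC] := boolP (a :&: b \in cycle_edges); last first.
  by rewrite (Cadj _ _ aC ab) in bC.
have [aT _ fa] := Cin _ aC.
have [abE|abE] := edges_v _ abC vab.
  by move: aC; rewrite (u1 a aT fa) ?(negPf t1C) // -abE subsetIl.
by move: aC; rewrite (u2 a aT fa) ?(negPf t2C) // -abE subsetIl.
Qed.

(** Walking along [c], the fans at consecutive vertices share the triangle of colour [i] on their
    common edge, and [c] reaches every vertex. *)
Lemma side_connected i t t' :
  t \in gverts (side i) -> t' \in gverts (side i) -> connect (gadj (side i)) t t'.
Proof.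
move=> ts t's.
have fan v a b : a \in gverts (side i) -> b \in gverts (side i) -> v \in a -> v \in b ->
    connect (gadj (side i)) a b.
  move=> aS bS va vb; apply: connect_sub (side_fan aS bS va vb) => x y /andP[xy _].
  exact: connect1.
have nonempty s : s \in gverts (side i) -> exists v, v \in s.
  by rewrite inE => /andP[sT _]; apply/card_gt0P; rewrite tri3.
have [[v vt] [v' vt']] := (nonempty _ ts, nonempty _ t's).
pose P x := forall s, s \in gverts (side i) -> x \in s -> connect (gadj (side i)) t s.
suff : P v' by apply.
apply: (@next_cycle_ind P v) => [s sS vs|x Px s sS xs]; first exact: fan vt vs.
have [a [aT fa ea _]] := cycle_edge_side i x.
have aS : a \in gverts (side i) by rewrite inE aT fa eqxx.
move: ea; rewrite sub2_set => /andP[xa nxa].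
by apply: connect_trans (Px a aS xa) (fan _ _ _ aS sS nxa xs).
Qed.

Lemma side_is_graph i : is_graph (side i).
Proof.
split=> [a b|a|a b /=].
- by rewrite /= tri_adj_sym [(f a == i) && _]andbC.
- by apply/negP => /andP[/(tri_adj_neq tri3)]; rewrite eqxx.
- by rewrite !inE => /and3P[/and3P[-> -> _] -> ->].
Qed.

(** The edge shared by [s] and [next d s] lies in [t] exactly when [t] is one of the two. As [next]
    permutes [d], each visit to [t] is counted twice. *)
Lemma crossing_cocycle i d t : cycle_in (side i) d -> t \in tri ->
  \sum_(e : {set V} | (#|e| == 2%N) && (e \subset t)) crossing d e = 0.
Proof.
case/and3P=> _ dcyc Ud tT; rewrite exchange_big /=.
rewrite big_seq (eq_bigr (fun s => (s == t) + (next d s == t))) => [|s sd].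
  rewrite -big_seq big_split /= (big_next _ (fun s => s == t)) //.
  by case: (\sum_(s <- d) _).
have /and3P[sn _ _] := next_cycle dcyc sd.
have [_ _ /eqP s2] := and3P sn.
have sST : (t == s) || (t == next d s) = (s :&: next d s \subset t).
  apply/orP/idP=> [[]/eqP->|sub]; rewrite ?subsetIl ?subsetIr //.
  by have [->|->] := edge_tris2 tri3 edge2 sn tT sub; [left|right].
rewrite [RHS](_ : _ = (s :&: next d s \subset t)); last first.
  rewrite -sST ![t == _]eq_sym; have := tri_adj_neq tri3 sn.
  case: (s =P t) => [->|_ _]; last by case: (_ == t).
  by rewrite eq_sym => /negPf->.
have [sub|nsub] := boolP (_ \subset t).
  rewrite (bigD1 (s :&: next d s)) ?s2 ?sub //= eqxx big1 // => e /andP[_ ne].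
  by rewrite eq_sym; apply/negbTE.
rewrite big1 // => e /andP[_ et]; apply/negbTE; apply: contra nsub => /eqP->.
exact: et.
Qed.

Lemma crossing_side i d e : cycle_in (side i) d -> crossing d e ->
  exists t t', [/\ tri_adj tri t t', f t = i, f t' = i & t :&: t' = e].
Proof.
case/and3P=> _ dcyc _ de.
have /hasP[t td /eqP te] : has (fun t => t :&: next d t == e) d.
  apply: contraT => /hasPn none; move: de; rewrite /crossing big_seq big1 //.
  by move=> t td; apply/negbTE/none.
have /and3P[tn /eqP ft /eqP fn] := next_cycle dcyc td.
by exists t, (next d t).
Qed.

(** The crossed edge determines the pair of triangles, and these pairs are distinct along a cycle of
    length at least 3; so the edge is crossed exactly once. *)
Lemma crossing_next i d t : cycle_in (side i) d -> t \in d ->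
  crossing d (t :&: next d t).
Proof.
case/and3P=> sd dcyc Ud td.
rewrite /crossing (bigD1_seq t) //= eqxx big_seq_cond big1 // => s.
case/andP=> sd' nst; apply/negbTE; apply: contra nst => /eqP sE.
have /and3P[sn _ _] := next_cycle dcyc sd'; have /and3P[sT snT /eqP s2] := sn.
have /and3P[tn _ _] := next_cycle dcyc td; have /and3P[tT tnT _] := tn.
apply/eqP/(next_edge_inj Ud sd) => //.
rewrite -(edge_trisE edge2 sT snT (tri_adj_neq tri3 sn) s2 (subsetIl _ _) (subsetIr _ _)).
rewrite sE; apply: (edge_trisE edge2) => //;
  rewrite ?(tri_adj_neq tri3) ?subsetIl ?subsetIr //.
by rewrite -sE.
Qed.

Lemma side_acyclic : exists i, forall d, ~~ cycle_in (side i) d.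
Proof.
have [[d0 cyc0]|no0] := pselect (exists d, cycle_in (side false) d); last first.
  by exists false => d; apply/negP => dC; apply: no0; exists d.
exists true => d1; apply/negP => cyc1.
pose d i := if i then d1 else d0.
have cyc i : cycle_in (side i) (d i) by case: i.
(* Both cycles enter [zeta], so that each side has an edge with value 1. *)
pose zeta e := crossing (d false) e + crossing (d true) e.
pose z u v := (u != v) && zeta [set u; v].
have z_coc t u v w : t \in tri -> u \in t -> v \in t -> w \in t -> z u v + z v w = z u w.
  apply: edge_cochain_cocycle => {}t tT.
  by rewrite big_split /= (crossing_cocycle cyc0) // (crossing_cocycle cyc1).
have noncross i e : e \in cycle_edges -> crossing (d i) e = false.
  move=> eC; apply/negP => /(crossing_side (cyc i))[t [t' [tt' ft ft' E]]].
  by have := f_adj tt'; rewrite ft ft' E eC; case: (i).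
have z_cyc x : z x (next c x) = 0.
  have eC : [set x; next c x] \in cycle_edges by apply: imset_f; rewrite cV.
  by rewrite /z /zeta !noncross // andbF.
have z_diag u : z u u = 0 by rewrite /z eqxx.
have [phi [phi_tri phi_adj]] :=
  filling z_diag z_coc z_cyc.
(* Within a fan the triangles meet along edges off [c], where [phi] has no boundary; along [c] the
   level is kept as [z] vanishes. So at a fixed level [phi] is constant on each side. *)
have phi_side i t t' v v' a : t \in gverts (side i) -> t' \in gverts (side i) ->
    v \in t -> v' \in t' -> phi t v a = phi t' v' a.
  move=> ts t's vt vt'.
  have fan x s s' : s \in gverts (side i) -> s' \in gverts (side i) ->
      x \in s -> x \in s' -> phi s x a = phi s' x a.
    move=> sS s'S xs xs'; have := side_fan sS s'S xs xs'.
    case/connectP=> p; elim: p s {sS xs} => [|y p IHp] s /=; first by move=> _ ->.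
    case/andP=> /andP[/and3P[sy /eqP fs /eqP fy] xsy] py lasts'.
    rewrite -(IHp y) //; have := phi_adj s y x a sy xsy.
    rewrite -f_adj // fs fy; case: (i); case: (phi s x a); by case: (phi y x a).
  pose P x := forall s, s \in gverts (side i) -> x \in s -> phi t v a = phi s x a.
  suff : P v' by apply.
  apply: (@next_cycle_ind P v) => [s sS vs|x Px s sS xs]; first exact: fan.
  have [b [bT fb eb _]] := cycle_edge_side i x.
  have bS : b \in gverts (side i) by rewrite inE bT fb eqxx.
  move: eb; rewrite sub2_set => /andP[xb nxb].
  rewrite (Px b bS xb) -(fan (next c x) b s bS sS nxb xs).
  by rewrite -(phi_tri b x (next c x)) // z_cyc addr0.
(* The edge between [t] and [t'] is crossed once by [d i] and never by the other cycle, so [z] is 1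
   on it; following it inside [t] switches the level. *)
have phi_flip i r w a : r \in gverts (side i) -> w \in r -> phi r w a = phi r w 0.
  move=> rS wr; have /and3P[sd dcyc _] := cyc i.
  have [t td] : exists t, t \in d i.
    by case: (d i) sd => [|t s] // _; exists t; rewrite mem_head.
  have := crossing_next (cyc i) td; set t' := next _ t => tt'.
  have := next_cycle dcyc td; rewrite -/t' => /and3P[at_' /eqP ft /eqP ft'].
  have /and3P[tT t'T /cards2P[u [v [nuv E]]]] := at_'.
  have tG : t \in gverts (side i) by rewrite inE tT ft eqxx.
  have [ut vt] : u \in t /\ v \in t.
    by apply/andP; rewrite -sub2_set -E subsetIl.
  have zuv : z u v = 1.
    rewrite /z nuv /zeta -E; clearbody t'.
    have other : crossing (d (~~ i)) (t :&: t') = false.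
      apply/negP => /(crossing_side (cyc (~~ i)))[q [q' [qq' fq fq' qE]]].
      have [] := edge_tris2 tri3 edge2 qq' tT; first by rewrite qE subsetIl.
        by move=> tq; move: fq; rewrite -tq ft; case: (i).
      by move=> tq; move: fq'; rewrite -tq ft; case: (i).
    by case: (i) tt' other => /= -> ->.
  have flip b : phi t v (b + 1) = phi t v b.
    by rewrite -zuv (phi_tri t u v) // (phi_side i t t u v).
  rewrite (phi_side i r t w v a) // (phi_side i r t w v 0) //.
  by case: a => //; rewrite -(flip 0).
have x : V by case: (c) sc => [|x p] // _.
have [t0 [t0T f0 e0 _]] := cycle_edge_side false x.
have [t1 [t1T f1 e1 _]] := cycle_edge_side true x.
have n01 : t0 != t1 by apply: contra_eq_neq f0 => ->; rewrite f1.
have e2 : #|[set x; next c x]| = 2%N by rewrite cards2 next_neq.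
have a01 := edge_tri_adj tri3 t0T t1T n01 e2 e0 e1.
have [x0 x1] : x \in t0 /\ x \in t1.
  by move: e0 e1; rewrite !sub2_set => /andP[-> _] /andP[-> _].
(* Across an edge of [c] the boundary is 1 at level 0 and 0 at level 1, although by [phi_flip]
   neither coefficient depends on the level. *)
have adj a := phi_adj t0 t1 x a a01.
have eC : t0 :&: t1 \in cycle_edges.
  by rewrite (tri_edgeI tri3 t0T t1T n01 e2 e0 e1); apply: imset_f; rewrite cV.
have := adj true; have := adj false; rewrite inE x0 x1 eC => /(_ isT) A0 /(_ isT).
rewrite (phi_flip false t0) ?(phi_flip true t1) ?inE ?t0T ?t1T ?f0 ?f1 //.
by rewrite A0.
Qed.

Lemma side_cover i : cover (gverts (side i)) = [set: V].
Proof.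
apply/setP=> v; rewrite inE; have [t [tT ft]] := cycle_edge_side i v.
rewrite sub2_set => /andP[vt _] _; apply/bigcupP; exists t => //.
by rewrite inE tT ft eqxx.
Qed.

End Coloured.

(** For [z] equal to 0 the cover is two disjoint copies, and the part of [phi] at level 0 is a set
    of triangles with boundary [c]. *)
Lemma colouring : exists f : {set V} -> bool, forall t t', tri_adj tri t t' ->
  f t + f t' = (t :&: t' \in cycle_edges).
Proof.
have [phi [phi_tri phi_adj]] := @filling (fun _ _ => 0) (fun _ => erefl)
  (fun _ _ _ _ _ _ _ _ => erefl) (fun _ => erefl).
exists (fun t : {set V} => if [pick x in t] is Some x then phi t x 0 else 0).
move=> t t' tt'.
have pickE (s : {set V}) x : s \in tri -> x \in s ->
    (if [pick x in s] is Some x then phi s x 0 else 0) = phi s x 0.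
  move=> sT xs; case: pickP => [y ys|/(_ x)]; last by rewrite xs.
  exact: (phi_tri s x y 0).
have /and3P[tT t'T /eqP e2] := tt'.
have /card_gt0P[x xe] : (0 < #|t :&: t'|)%N by rewrite e2.
have [xt xt'] := setIP xe.
by rewrite (pickE t x) // (pickE t' x) // phi_adj // andbT.
Qed.

(** The acyclic side is a stacked disk covering every vertex, so the length of its boundary cycle
    gives the vertex count. The last clause comes from the opposite side and prepares condition
    (2). *)
Lemma hamiltonian_tree : exists G : graph {set V},
  [/\ is_tree G, gverts G \subset tri /\ subrel (gadj G) (tri_adj tri),
      (#|gverts G| + 2 = #|V|)%N,
      forall v t t', t \in gverts G -> t' \in gverts G -> v \in t -> v \in t' ->
        connect (fun a b => gadj G a b && (v \in a :&: b)) t t'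
    & forall v, exists t, [/\ t \in tri, v \in t & t \notin gverts G]].
Proof.
have [f f_adj] := colouring; have [i acyc] := side_acyclic f_adj.
have tree : is_tree (side f i).
  by split=> [|t t'|//]; [apply: side_is_graph | apply: side_connected].
have GT : gverts (side f i) \subset tri by apply/subsetP=> t; rewrite inE => /andP[].
have Gadj : subrel (gadj (side f i)) (tri_adj tri) by move=> t t' /andP[].
have v0 : V by case: (c) sc => [|x s] // _.
have other v : exists t, [/\ t \in tri, v \in t & t \notin gverts (side f i)].
  have [t [tT ft e _]] := cycle_edge_side f_adj (~~ i) v; exists t; split=> //.
    by move: e; rewrite sub2_set => /andP[].
  by rewrite inE tT ft; case: (i).
exists (side f i); split=> //; last first.
  by move=> v t t'; apply: side_fan.
have ne0 : gverts (side f i) != set0.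
  apply: contraTneq (in_setT v0) => G0; rewrite -(side_cover f_adj i) G0.
  by rewrite /cover big_set0 inE.
have st := tree_stacked tri3 tree ne0 GT Gadj (@side_fan f f_adj i).
have [c' [Uc' sc' c'E _ _]] := stacked_boundary tri3 edge2 st GT.
rewrite addn2 -sc' -(card_uniqP Uc'); apply: eq_card => v.
by rewrite c'E side_cover ?inE.
Qed.

End Filling.

(* Imported only here: classical_sets shadows the lemma names of finset. *)
From mathcomp Require Import all_classical all_reals all_analysis.
From mathcomp Require Import ring lra.
Import numFieldNormedType.Exports.
Local Open Scope classical_set_scope.
Local Open Scope ring_scope.

(** * Moving homotopies between the surface and barycentric coordinates *)

Lemma within_continuous_comp (X Y Z : topologicalType) (A : set X) (B : set Y)
    (f : X -> Y) (g : Y -> Z) :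
  set_fun A B f -> {within A, continuous f} -> {within B, continuous g} ->
  {within A, continuous (g \o f)}.
Proof.
move=> fAB /subspace_continuousP cf /subspace_continuousP cg.
apply/subspace_continuousP => x Ax U Ugfx.
have := cg _ (fAB _ Ax) U Ugfx; rewrite /= nbhs_simpl /within /= => VB.
have := cf _ Ax _ VB; rewrite !nbhs_simpl /within /=.
by apply: filterS => y fy Ay; apply: fy => //; apply: fAB.
Qed.

Lemma continuous_pair (X Y Z : topologicalType) (f : X -> Y) (g : X -> Z) :
  continuous f -> continuous g -> continuous (fun x => (f x, g x)).
Proof. by move=> cf cg x; apply: cvg_pair; [apply: cf | apply: cg]. Qed.

Lemma within_continuous_pair (X Y Z : topologicalType) (A : set X)
    (f : X -> Y) (g : X -> Z) :
  {within A, continuous f} -> {within A, continuous g} ->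
  {within A, continuous (fun x => (f x, g x))}.
Proof.
move=> /subspace_continuousP cf /subspace_continuousP cg.
by apply/subspace_continuousP => x Ax; apply: cvg_pair; [apply: cf | apply: cg].
Qed.

(** Conjugation by [h] and its inverse moves the homotopy. The ambient space of [G] may be larger
    than [B], so staying in [B] becomes an explicit clause. *)
Lemma null_homotopic_homeo (R : realType) (X S : topologicalType) (A B : set X)
    (h : X -> S) :
  homeomorphism_on B [set: S] h -> A `<=` B ->
  null_homotopic_in R (h @` A) <->
  exists (G : X * R -> X) (p : X), {within A `*` `[0, 1], continuous G} /\
    forall x, A x -> [/\ G (x, 0) = x, G (x, 1) = p &
      forall s, s \in `[0, 1] -> B (G (x, s))].
Proof.
move=> [g [hB gB [ghK hgK] ch cg]] AB.
have cT (Y Z : topologicalType) (D : set Y) (f : Y -> Z) : continuous f ->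
  {within D, continuous f} by move=> cf; apply: continuous_subspaceT.
split=> [[H [p [cH Hp]]]|[G [p [cG Gp]]]].
  exists (fun z => g (H (h z.1, z.2))), (g p); split; last first.
    move=> x Ax; have [H0 H1] : H (h x, 0) = h x /\ H (h x, 1) = p.
      by apply: Hp; exists x.
    by split=> [||s _] /=; rewrite ?H0 ?H1 ?ghK //; [apply: AB | apply: gB].
  apply: (@within_continuous_comp _ _ _ _ [set: S]
    (fun z : X * R => H (h z.1, z.2)) g) => //.
  apply: (@within_continuous_comp _ _ _ _ ((h @` A) `*` `[(0 : R), 1])
    (fun z : X * R => (h z.1, z.2)) H _ _ cH) => //.
    by move=> -[x s] [/= Ax sI]; split => //; exists x.
  apply: within_continuous_pair; last by apply: cT => z; apply: cvg_snd.
  apply: (@within_continuous_comp _ _ _ _ B fst h) => //.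
    by move=> -[x s] [/= Ax _]; apply: AB.
  by apply: cT => z; apply: cvg_fst.
exists (fun z => h (G (g z.1, z.2))), (h p); split; last first.
  move=> _ [x Ax <-] /=; have [G0 G1 _] := Gp _ Ax.
  by rewrite ghK ?G0 ?G1 //; apply: AB.
apply: (@within_continuous_comp _ _ _ _ B (fun z : S * R => G (g z.1, z.2)) h) => //.
  move=> -[y s] [/= [x Ax <-] sI]; rewrite ghK; last exact: AB.
  by have [_ _] := Gp _ Ax; apply.
apply: (@within_continuous_comp _ _ _ _ (A `*` `[(0 : R), 1])
  (fun z : S * R => (g z.1, z.2)) G) => //.
  by move=> -[y s] [/= [x Ax <-] sI]; split => //=; rewrite ghK //; apply: AB.
apply: within_continuous_pair; last by apply: cT => z; apply: cvg_snd.
apply: (@within_continuous_comp _ _ _ _ [set: S] fst g) => //.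
by apply: cT => z; apply: cvg_fst.
Qed.

(** * Contraction of a stacked disk *)

Section Realization.
Variables (R : realType) (n : nat).
Implicit Types (x : 'rV[R]_n) (U : {set {set 'I_n}}).

Definition support x : {set 'I_n} := [set i | x ord0 i != 0]%SET.

Definition barycentric x := (forall i, 0 <= x ord0 i) /\ \sum_i x ord0 i = 1.

Definition carrier U : set 'rV[R]_n :=
  [set x | barycentric x /\ exists2 t, t \in U & support x \subset t].

Definition vertex (i : 'I_n) : 'rV[R]_n := delta_mx ord0 i.

(* At time 1 this is the simplicial map sending w to u. *)
Definition collapse (u w : 'I_n) (z : 'rV[R]_n * R) : 'rV[R]_n :=
  z.1 + (z.2 * z.1 ord0 w) *: (vertex u - vertex w).

Lemma collapseE u w x s i :
  collapse u w (x, s) ord0 i = x ord0 i + s * x ord0 w * ((i == u)%:R - (i == w)%:R).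
Proof. by rewrite /collapse !mxE !eqxx. Qed.

Lemma collapse_continuous u w : continuous (collapse u w).
Proof.
move=> z; apply: cvgD; first exact: cvg_fst.
apply: cvgZr_tmp; apply: cvgM; first exact: cvg_snd.
apply: (@continuous_comp _ _ _ fst (fun x : 'rV[R]_n => x ord0 w)).
  exact: cvg_fst.
exact: coord_continuous.
Qed.

Lemma collapse_barycentric u w x s : u != w -> 0 <= s <= 1 ->
  barycentric x -> barycentric (collapse u w (x, s)).
Proof.
move=> nuw /andP[s0 s1] [x0 x1]; split=> [i|].
  have [xi xw] := (x0 i, x0 w).
  rewrite collapseE; have [->|iu] := eqVneq i u.
    by rewrite (negPf nuw) subr0 mulr1 addr_ge0 // mulr_ge0.
  have [->|iw] := eqVneq i w; last by rewrite subr0 mulr0 addr0.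
  by rewrite add0r mulrN1 subr_ge0 ler_piMl.
under eq_bigr do rewrite collapseE; rewrite big_split /= x1 -mulr_sumr sumrB.
have one (k : 'I_n) : \sum_i (i == k)%:R = 1 :> R.
  by rewrite (bigD1 k) //= eqxx big1 ?addr0 // => i /negPf->.
by rewrite !one subrr mulr0 addr0.
Qed.

Lemma collapse_support u w x s (t : {set 'I_n}) : u \in t -> w \in t ->
  support x \subset t -> support (collapse u w (x, s)) \subset t.
Proof.
move=> ut wt /fintype.subsetP xt; apply/fintype.subsetP => i; rewrite inE collapseE.
have [->//|iu] := eqVneq i u; have [->//|iw] := eqVneq i w.
by rewrite subrr mulr0 addr0 => xi; apply: xt; rewrite inE.
Qed.

(** The first half of the time pushes the newest vertex [w] to a vertex [u] of the shared edge; the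
    second half runs the contraction of the smaller disk. *)
Lemma stacked_contractible U : stacked U ->
  exists (G : 'rV[R]_n * R -> 'rV[R]_n) (p : 'rV[R]_n),
  [/\ continuous G, forall x, G (x, 0) = x
    & forall x, carrier U x -> G (x, 1) = p /\
        forall s, 0 <= s <= 1 -> carrier U (G (x, s))].
Proof.
elim=> {U} [t t3|U t p sU [G [q [cG G0 GU]]] pU t3 tp2 newv].
  have [a at_] : exists a, a \in t by apply/card_gt0P; rewrite t3.
  exists (fun z => z.1 + z.2 *: (vertex a - z.1)), (vertex a); split=> [z|x|x].
  - apply: cvgD; first exact: cvg_fst.
    apply: cvgZ; first exact: cvg_snd.
    by apply: cvgB; [exact: cvg_cst | exact: cvg_fst].
  - by rewrite /= scale0r addr0.
  - case=> -[x0 x1] [t']; rewrite inE => /eqP -> /fintype.subsetP xt.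
    split; first by rewrite /= scale1r addrCA subrr addr0.
    move=> s /andP[s0 s1].
    have E i : (x + s *: (vertex a - x)) ord0 i = (1 - s) * x ord0 i + s * (i == a)%:R.
      by rewrite !mxE eqxx /=; ring.
    split; last first.
      exists t; rewrite ?inE //; apply/fintype.subsetP => i; rewrite inE E.
      have [->//|_] := eqVneq i a; rewrite mulr0 addr0 => xi; apply: xt.
      by rewrite inE; apply: contraNneq xi => ->; rewrite mulr0.
    split=> [i|]; first by rewrite E addr_ge0 ?mulr_ge0 ?subr_ge0.
    under eq_bigr do rewrite E; rewrite big_split /= -!mulr_sumr x1 mulr1.
    rewrite (bigD1 a) //= eqxx big1 ?addr0 ?mulr1 ?subrK // => i /negPf->.
    by [].
have tp : t != p.
  by apply/eqP=> E; move: tp2; rewrite -E finset.setIid t3.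
have [w wt wp] : exists2 w, w \in t & w \notin p.
  by apply/fintype.subsetPn; apply/negP => /finset.setIidPl I; rewrite I t3 in tp2.
have [u utp] : exists u, u \in t :&: p by apply/card_gt0P; rewrite tp2.
have [ut up] := finset.setIP utp.
have nuw : u != w by apply: contraNneq wp => <-.
(* Clocks of the two halves: on the time interval, [lo] runs from 0 to 1 until time 1/2 and then
   stops, [hi] waits at 0 and then runs to 1. *)
pose lo (z : 'rV[R]_n * R) : R := Num.min 1 (2 * z.2).
pose hi (z : 'rV[R]_n * R) : R := Num.max 0 (2 * z.2 - 1).
have c2 (z : 'rV[R]_n * R) : {for z, continuous (fun z : 'rV[R]_n * R => 2 * z.2 : R^o)}.
  by apply: cvgM; [exact: cvg_cst | exact: cvg_snd].
have cc (k : R) z : {for z, continuous (fun z : 'rV[R]_n * R => k : R^o)} by exact: cvg_cst.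
have clo : continuous lo by move=> z; exact: continuous_min (cc 1 z) (c2 z).
have chi : continuous hi.
  move=> z; have c21 : {for z, continuous (fun z : 'rV[R]_n * R => 2 * z.2 - 1 : R^o)}.
    by apply: cvgB; [exact: c2 | exact: cvg_cst].
  exact: continuous_max (cc 0 z) c21.
exists (fun z => G (collapse u w (z.1, lo z), hi z)), q; split=> [z|x|x].
- have cfst : continuous (fst : 'rV[R]_n * R -> 'rV[R]_n) by move=> y; exact: cvg_fst.
  have cr : continuous (fun z => collapse u w (z.1, lo z)).
    have cp : continuous (fun z => (z.1, lo z)) by exact: continuous_pair.
    by move=> y; apply: (continuous_comp (cp y)); exact: collapse_continuous.
  have cp : continuous (fun z => (collapse u w (z.1, lo z), hi z)) by exact: continuous_pair.
  exact: (continuous_comp (cp z) (cG _)).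
- rewrite /lo /hi /= mulr0 sub0r; have -> : Num.min 1 0 = 0 :> R by rewrite min_r.
  have -> : Num.max 0 (-1) = 0 :> R by rewrite max_l // oppr_le0.
  by rewrite G0 /collapse /= mul0r scale0r addr0.
- case=> bx [t' t'U xt'].
  have low s : 0 <= s <= 1 -> carrier (t |: U) (collapse u w (x, s)).
    move=> sI; split; first exact: collapse_barycentric.
    case/finset.setU1P: t'U => [tE|t'U].
      by exists t; [exact: finset.setU11|rewrite -tE in ut wt *; apply: collapse_support].
    exists t'; first exact: finset.setU1r.
    (* Only the glued triangle contains [w], so a point of another triangle has weight 0 there and
       does not move. *)
    have xw : x ord0 w = 0.
      apply: contraNeq (newv w wt wp) => xw; apply/bigcupP; exists t' => //.
      by apply: (fintype.subsetP xt'); rewrite inE.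
    by rewrite /collapse /= xw mulr0 scale0r addr0.
  (* At time 1 the weight at [w] is 0, so a point of [t] has reached the edge [t :&: p]. *)
  have high : carrier U (collapse u w (x, 1)).
    split; first by apply: collapse_barycentric; rewrite ?lexx ?ler01.
    case/finset.setU1P: t'U => [tE|t'U]; last first.
      have xw : x ord0 w = 0.
        apply: contraNeq (newv w wt wp) => xw; apply/bigcupP; exists t' => //.
        by apply: (fintype.subsetP xt'); rewrite inE.
      by exists t' => //; rewrite /collapse /= xw mulr0 scale0r addr0.
    exists p => //; have ct : support (collapse u w (x, 1)) \subset t.
      by rewrite -tE in ut wt *; apply: collapse_support.
    have tI : t = w |: t :&: p.
      apply/esym/eqP; rewrite eqEcard finset.subUset finset.sub1set wt finset.subsetIl t3.
      by rewrite cardsU1 inE (negPf wp) andbF tp2.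
    apply/fintype.subsetP => i iS; have := fintype.subsetP ct _ iS.
    rewrite tI => /finset.setU1P[iw|].
      move: iS; rewrite inE collapseE iw eqxx [w == u]eq_sym (negPf nuw).
      by rewrite mul1r sub0r mulrN1 subrr eqxx.
    by rewrite inE => /andP[].
  split.
    have [+ _] := GU _ high; rewrite /lo /hi /= mulr1.
    have -> : Num.min 1 2 = 1 :> R by rewrite min_l // ler1n.
    have -> : Num.max 0 (2 - 1) = 1 :> R by rewrite max_r; lra.
    by [].
  move=> s /andP[s0 s1]; rewrite /lo /hi /=.
  have [s2|s2] := leP (2 * s) 1.
    have -> : Num.max 0 (2 * s - 1) = 0 :> R by rewrite max_l; lra.
    by rewrite G0; apply: low; rewrite s2 mulr_ge0.
  have -> : Num.max 0 (2 * s - 1) = 2 * s - 1 :> R by rewrite max_r; lra.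
  have [_ /(_ (2 * s - 1))[|]] := GU _ high; first by lra.
  by move=> b [r rU rs]; split=> //; exists r => //; apply: finset.setU1r.
Qed.

End Realization.

(** * Trivial holonomy of null-homotopic cycles *)

(** Heine-Cantor: around each point [f] varies by less than e/2 within some radius, and compactness
    makes half of these radii uniform. *)
Lemma compact_uniform_continuity (R : realType) (X Y : pseudoMetricType R)
    (A : set X) (f : X -> Y) (e : R) :
  compact A -> {within A, continuous f} -> 0 < e ->
  \forall d \near 0^'+, forall x y, A x -> A y -> ball x d y -> ball (f x) e (f y).
Proof.
move=> /compact_near_coveringP cA /subspace_continuousP cf e0.
pose P (d : R) x := A x -> forall y, A y -> ball x d y -> ball (f x) e (f y).
have e20 : 0 < e / 2 by rewrite divr_gt0.
have nP : \forall d \near 0^'+, A `<=` P d.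
  apply: cA => x Ax; have /cvg_ballP/(_ _ e20) := cf x Ax.
  rewrite near_withinE => /nbhs_ballP[r /= r0 xr].
  have r20 : 0 < r / 2 by rewrite divr_gt0.
  exists (ball x (r / 2), [set d | d < r / 2]).
    by split; [exact: nbhsx_ballx | exact: nbhs_right_lt].
  move=> [x' d] [/= xx' dr] Ax' y Ay x'y.
  have fx : ball (f x) (e / 2) (f x').
    by apply: xr => //; apply: le_ball xx'; rewrite ler_pdivrMr // ler_pMr // ler1n.
  apply: ball_splitr fx _; apply: xr => //.
  by apply: (ball_split xx'); apply: le_ball x'y; exact: ltW.
by near=> d => x y Ax Ay xy; apply: (near nP d).
Unshelve. all: by end_near.
Qed.

Section Holonomy.
Variables (R : realType) (n : nat) (K : {set {set 'I_n}}) (X : Type).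
Variable tau : 'I_n -> 'I_n -> X -> X.
Hypothesis tau_flat : flat_transport K tau.

Lemma transport_simplex s x p a : s \in K -> x \in s -> {subset p <= s} ->
  transport tau x p a = tau x (last x p) a.
Proof.
case: tau_flat => tau1 tauM sK; elim: p x a => [|y p IHp] x a xs ps /=.
  by rewrite tau1.
have ys : y \in s by apply: ps; rewrite mem_head.
rewrite IHp // => [|z zp]; last by apply: ps; rewrite inE zp orbT.
apply: (tauM s) => //; case: p {IHp} ps => [|z p] ps //=.
by apply: ps; rewrite inE mem_last orbT.
Qed.

Definition in_simplex (T : Type) (f g : T -> 'I_n) (x y : T) :=
  [exists s in K, [&& f x \in s, f y \in s, g x \in s & g y \in s]].

(** [f] and [g] label two adjacent rows of a grid. Each square lies in one simplex, where flatness
    makes the two ways around it agree. *)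
Lemma transport_strip (T : Type) (f g : T -> 'I_n) x (p : seq T) a :
  path (in_simplex f g) x p ->
  tau (f (last x p)) (g (last x p)) (transport tau (f x) (map f p) a) =
  transport tau (g x) (map g p) (tau (f x) (g x) a).
Proof.
case: tau_flat => tau1 tauM; elim: p x a => //= y p IHp x a /andP[].
case/existsP=> s /andP[sK /and4P[fx fy gx gy]] yp; rewrite IHp //.
by rewrite !(tauM s).
Qed.

(** The first and last rungs coincide, so the holonomies of the rows are conjugate. A nonempty [p]
    provides a simplex containing [f x] and [g x], on which the rung is invertible. *)
Lemma transport_strip_loop (T : Type) (f g : T -> 'I_n) x (p : seq T) :
  path (in_simplex f g) x p -> (0 < size p)%N -> last x p = x ->
  (forall a, transport tau (g x) (map g p) a = a) ->
  forall a, transport tau (f x) (map f p) a = a.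
Proof.
move=> fg np lastp hg a; have := transport_strip a fg; rewrite lastp hg.
have [tau1 tauM] := tau_flat.
have [s sK [fx gx]] : exists2 s, s \in K & f x \in s /\ g x \in s.
  case: p np fg {lastp hg} => // y q _ /= /andP[/existsP[s /andP[sK]]].
  by case/and4P=> fx _ gx _ _; exists s.
move/(congr1 (tau (g x) (f x))).
by rewrite !(tauM s) // !tau1.
Qed.

End Holonomy.

Lemma path_map_iota (T : Type) (e : rel T) (g : nat -> T) a m :
  (forall k, (a <= k < a + m)%N -> e (g k) (g k.+1)) ->
  path e (g a) [seq g k | k <- iota a.+1 m].
Proof.
elim: m a => //= m IHm a ge; rewrite ge ?IHm ?leqnn ?addnS ?leq_addr // => k.
case/andP=> ak km; apply: ge; rewrite (ltnW ak) /=.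
by rewrite addSn addnS in km *.
Qed.

Lemma last_map_iota (T : Type) (g : nat -> T) a m :
  last (g a) [seq g k | k <- iota a.+1 m] = g (a + m)%N.
Proof. by elim: m a => [|m IHm] a /=; rewrite ?addn0 // IHm addSnnS. Qed.

Section EdgePoints.
Variables (R : realType) (n : nat).
Implicit Types (u v : 'I_n) (x y : 'rV[R]_n).

Definition edge_point u v (r : R) : 'rV[R]_n :=
  (1 - r) *: vertex R u + r *: vertex R v.

Lemma edge_pointE u v r i :
  edge_point u v r ord0 i = (1 - r) * (i == u)%:R + r * (i == v)%:R.
Proof. by rewrite !mxE !eqxx. Qed.

Lemma edge_point0 u v : edge_point u v 0 = vertex R u.
Proof. by rewrite /edge_point subr0 scale1r scale0r addr0. Qed.

Lemma edge_point1 u v : edge_point u v 1 = vertex R v.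
Proof. by rewrite /edge_point subrr scale1r scale0r add0r. Qed.

Lemma edge_point_barycentric u v r : 0 <= r <= 1 -> barycentric (edge_point u v r).
Proof.
case/andP=> r0 r1; split=> [i|].
  by rewrite edge_pointE addr_ge0 // mulr_ge0 ?subr_ge0.
under eq_bigr do rewrite edge_pointE; rewrite big_split /= -!mulr_sumr.
have one (k : 'I_n) : \sum_i (i == k)%:R = 1 :> R.
  by rewrite (bigD1 k) //= eqxx big1 ?addr0 // => i /negPf->.
by rewrite !one !mulr1 subrK.
Qed.

Lemma support_edge_point u v r : support (edge_point u v r) \subset [set u; v]%SET.
Proof.
apply/fintype.subsetP => i; rewrite !inE edge_pointE.
by case: (i =P u) => //= _; case: (i =P v) => //= _; rewrite !mulr0 addr0 eqxx.
Qed.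

Lemma realization_barycentric (K : {set {set 'I_n}}) x :
  realization R K x -> barycentric x.
Proof. by case. Qed.

Lemma barycentric_support x : barycentric x -> support x != finset.set0.
Proof.
case=> x0 x1; apply/negP => /eqP E; have := x1; rewrite big1; last first.
  by move=> i _; apply/eqP; have := finset.in_set0 i; rewrite -E inE => /negbFE.
by move/eqP; rewrite eq_sym oner_eq0.
Qed.

Lemma realization_edge (K : {set {set 'I_n}}) u v r :
  [set u]%SET \in K -> [set v]%SET \in K -> [set u; v]%SET \in K ->
  0 <= r <= 1 -> realization R K (edge_point u v r).
Proof.
move=> uK vK uvK rI; have b := edge_point_barycentric u v rI; case: (b) => b0 b1.
split=> //; rewrite -/(support _); have := support_edge_point u v r.
have := barycentric_support b; move: (support _) => s s0 suv.
have [us|us] := boolP (u \in s); have [vs|vs] := boolP (v \in s).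
- suff -> : s = [set u; v]%SET by [].
  by apply/eqP; rewrite finset.eqEsubset suv finset.subUset !finset.sub1set us.
- suff -> : s = [set u]%SET by [].
  apply/eqP; rewrite finset.eqEsubset finset.sub1set us andbT; apply/fintype.subsetP => i is_.
  have := fintype.subsetP suv i is_; rewrite !inE => /orP[//|/eqP iv].
  by rewrite -iv is_ in vs.
- suff -> : s = [set v]%SET by [].
  apply/eqP; rewrite finset.eqEsubset finset.sub1set vs andbT; apply/fintype.subsetP => i is_.
  have := fintype.subsetP suv i is_; rewrite !inE => /orP[/eqP iu|//].
  by rewrite -iu is_ in us.
- case/finset.set0Pn: s0 => i is_; have := fintype.subsetP suv i is_.
  by rewrite !inE => /orP[]/eqP iE; rewrite -iE is_ in us vs.
Qed.

Lemma edge_point_continuous u v : continuous (edge_point u v).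
Proof.
move=> r; apply: cvgD; apply: cvgZr_tmp; last exact: cvg_id.
by apply: cvgB; [exact: cvg_cst | exact: cvg_id].
Qed.

Variable v0 : 'I_n.

Definition top_vertex x : 'I_n := odflt v0 [pick i | n%:R^-1 <= x ord0 i].

Lemma top_vertexP x : barycentric x -> n%:R^-1 <= x ord0 (top_vertex x).
Proof.
case=> x0 x1; rewrite /top_vertex; case: pickP => //= none.
have n0 : (0 < n)%N := leq_ltn_trans (leq0n v0) (ltn_ord v0).
have : \sum_i (n%:R^-1 - x ord0 i) = 0.
  rewrite sumrB x1 sumr_const card_ord -[X in X - _]mulr_natr.
  by rewrite mulVf ?subrr // pnatr_eq0 -lt0n.
move/eqP; rewrite psumr_eq0 => [/allP/(_ v0 (mem_index_enum _))|i _]; last first.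
  by rewrite subr_ge0 ltW // ltNge none.
by rewrite /= subr_eq0 => /eqP E; have := none v0; rewrite E lexx.
Qed.

(** A vertex of weight 0 at [x] has weight below 1/n at [y]. Hence the labels of all barycentric
    points within 1/n of [x] lie in the support of [x]. *)
Lemma top_vertex_near x y : barycentric y -> ball x n%:R^-1 y ->
  top_vertex y \in support x.
Proof.
move=> /top_vertexP ty [_ xy]; rewrite inE; apply: contraTneq ty => x0.
have := xy ord0 (top_vertex y); rewrite /ball /= x0 sub0r normrN -ltNge => h.
exact: le_lt_trans (ler_norm _) h.
Qed.

Lemma top_vertex_support x : barycentric x -> top_vertex x \in support x.
Proof.
move=> bx; have n0 : (0 < n)%N := leq_ltn_trans (leq0n v0) (ltn_ord v0).
by apply: top_vertex_near => //; apply: ballxx; rewrite invr_gt0 ltr0n.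
Qed.

Lemma top_vertex_vertex u : top_vertex (vertex R u) = u.
Proof.
have b : barycentric (vertex R u).
  by rewrite -(edge_point0 u u); apply: edge_point_barycentric; rewrite lexx ler01.
have := top_vertex_support b; rewrite inE !mxE eqxx /=.
by case: (top_vertex _ =P u) => //= _; rewrite eqxx.
Qed.

End EdgePoints.

Section NullHomotopicHolonomy.
Variables (R : realType) (n : nat) (K : {set {set 'I_n}}) (c : seq 'I_n).
Variables (G : 'rV[R]_n * R -> 'rV[R]_n) (p0 : 'rV[R]_n).
Let A : set 'rV[R]_n := realization R (cycle_complex c).
Hypothesis G_continuous : {within A `*` `[0, 1], continuous G}.
Hypothesis G_homotopy : forall x, A x -> [/\ G (x, 0) = x, G (x, 1) = p0 &
  forall s, s \in `[0, 1] -> realization R K (G (x, s))].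
Hypothesis cK : cycle_complex c \subset K.
Variables (X : Type) (tau : 'I_n -> 'I_n -> X -> X).
Hypothesis tau_flat : flat_transport K tau.

Lemma cycle_point u (r : R) : u \in c -> 0 <= r <= 1 -> A (edge_point u (next c u) r).
Proof.
move=> uc rI; have nc : next c u \in c by rewrite mem_next.
apply: realization_edge => //; rewrite finset.inE.
- by apply/orP; left; apply: imset_f.
- by apply/orP; left; apply: imset_f.
- by apply/orP; right; apply: (imset_f (fun v => [set v; next c v]%SET)).
Qed.

(** Uniform continuity over the finitely many edges of [c] gives a common radius d, and any m above
    1/d serves. *)
Lemma grid_mesh : exists2 m : nat, (0 < m)%N & forall u k j k' j', u \in c ->
  (k <= m)%N -> (j <= m)%N -> (k' <= m)%N -> (j' <= m)%N ->
  (k' <= k.+1)%N -> (k <= k'.+1)%N -> (j' <= j.+1)%N -> (j <= j'.+1)%N ->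
  ball (G (edge_point u (next c u) (k%:R / m%:R), j%:R / m%:R)) n%:R^-1
       (G (edge_point u (next c u) (k'%:R / m%:R), j'%:R / m%:R)).
Proof.
pose F u (z : R * R) := G (edge_point u (next c u) z.1, z.2).
pose I2 : set (R * R) := `[0, 1] `*` `[0, 1].
have : \forall d \near 0^'+, forall u : 'I_n, u \in c -> forall z z' : R * R,
    I2 z -> I2 z' -> ball z d z' ->
    ball (F u z) n%:R^-1 (F u z').
  apply: filter_forall => u; have [uc|uc] := boolP (u \in c); last first.
    by apply: nearW.
  have n0 : (0 < n)%N := leq_ltn_trans (leq0n u) (ltn_ord u).
  have : {within I2, continuous (F u)}.
    apply: (@within_continuous_comp _ _ _ _ (A `*` `[(0 : R), 1])
      (fun z : R * R => (edge_point u (next c u) z.1, z.2)) G _ _ G_continuous).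
      move=> -[r s] [/= rI sI]; split => //=; apply: cycle_point => //.
    apply: continuous_subspaceT; apply: continuous_pair => z; last exact: cvg_snd.
    apply: (@continuous_comp _ _ _ fst (edge_point u (next c u))).
      exact: cvg_fst.
    exact: edge_point_continuous.
  move=> cF; have n1 : 0 < n%:R^-1 :> R by rewrite invr_gt0 ltr0n.
  have cI : compact I2.
    by apply: compact_setX; exact: segment_compact.
  have := compact_uniform_continuity cI cF n1.
  by apply: filterS => d dP _ z z'; apply: dP.
move=> nd; have [d [d0 dP]] : exists d : R, 0 < d /\
    forall u : 'I_n, u \in c -> forall z z' : R * R, I2 z -> I2 z' -> ball z d z' ->
    ball (F u z) n%:R^-1 (F u z').
  apply: (@filter_ex _ (0^'+ : set_system R)); near=> d.
  by split; near: d; [exact: nbhs_right_gt|].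
have [m md] : exists m : nat, d^-1 < m%:R.
  by exists (Num.bound d^-1); apply: archi_boundP; rewrite invr_ge0 ltW.
have m0 : 0 < m%:R :> R by apply: lt_trans md; rewrite invr_gt0.
have mN : (0 < m)%N by rewrite -(ltr0n R).
have md' : m%:R^-1 < d by rewrite -[d]invrK ltf_pV2 ?posrE ?invr_gt0.
exists m => // u k j k' j' uc km jm k'm j'm kk kk' jj jj'.
have I01 (i : nat) : (i <= m)%N -> [set` `[0, 1]] (i%:R / m%:R : R).
  by move=> im; rewrite /= in_itv /= divr_ge0 //= ler_pdivrMr // mul1r ler_nat.
have close (i i' : nat) : (i' <= i.+1)%N -> (i <= i'.+1)%N ->
    ball (i%:R / m%:R : R) d (i'%:R / m%:R).
  move=> h h'; apply: le_lt_trans md'.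
  rewrite -mulrBl normrM [X in _ * X]ger0_norm ?invr_ge0 //.
  rewrite ler_piMl ?invr_ge0 // ler_norml.
  have : i'%:R <= i%:R + 1 :> R by rewrite natr1 ler_nat.
  have : i%:R <= i'%:R + 1 :> R by rewrite natr1 ler_nat.
  by move=> ? ?; apply/andP; split; lra.
by apply: (dP u uc (k%:R / m%:R, j%:R / m%:R) (k'%:R / m%:R, j'%:R / m%:R)); split;
  do ?[exact: I01]; apply: close.
Unshelve. all: by end_near.
Qed.

(** Each edge contributes its points for k from 1 to m; the start [x] is left out because [path] and
    [transport] take it separately. *)
Fixpoint refine (m : nat) (x : 'I_n) (p : seq 'I_n) : seq 'rV[R]_n :=
  if p is y :: p' then
    [seq edge_point x (next c x) (k%:R / m%:R) | k <- iota 1 m] ++ refine m y p'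
  else [::].

(* On a fine grid, moving each grid point to a vertex where it has weight
   at least 1/n makes the homotopy simplicial: the vertices at the corners of a grid
   square span a simplex, so all rows have the same holonomy. *)
Lemma null_homotopic_holonomy x0 p : uniq c -> c = x0 :: p ->
  forall a, transport tau x0 (rcons p x0) a = a.
Proof.
move=> Uc cE a; have [m m0 mesh] := grid_mesh.
have mR : m%:R != 0 :> R by rewrite pnatr_eq0 -lt0n.
pose t (k : nat) : R := k%:R / m%:R.
have t0 : t 0 = 0 by rewrite /t mul0r.
have tm : t m = 1 by rewrite /t divff.
have tI k : (k <= m)%N -> 0 <= t k <= 1.
  by move=> km; rewrite divr_ge0 //= ler_pdivrMr ?ltr0n // mul1r ler_nat.
pose pt u k := edge_point u (next c u) (t k).
have ptA u k : u \in c -> (k <= m)%N -> A (pt u k).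
  by move=> uc km; apply: cycle_point (tI _ km).
pose f j x := top_vertex x0 (G (x, t j)).
pose loop := refine m x0 (rcons p x0).
have cyc : path (frel (next c)) x0 (rcons p x0).
  by move: (next c) (cycle_next Uc) => g; rewrite cE.
have x0c : x0 \in c by rewrite cE mem_head.
have GK x j : A x -> (j <= m)%N -> realization R K (G (x, t j)).
  by move=> Ax jm; have [_ _] := G_homotopy Ax; apply; rewrite in_itv /= tI.
have refine_ind (P : 'I_n -> seq 'I_n -> Prop) :
    (forall x, x \in c -> P x [::]) ->
    (forall x q, x \in c -> P (next c x) q -> P x (next c x :: q)) ->
    forall q x, x \in c -> path (frel (next c)) x q -> P x q.
  move=> P0 PS; elim=> [|y q IHq] x xc /=; first by move=> _; apply: P0.
  by case/andP=> /eqP<- qp; apply: PS => //; apply: IHq => //; rewrite mem_next.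
have pt0 u : pt u 0%N = vertex R u by rewrite /pt t0 edge_point0.
have last_seg u : last (vertex R u) [seq pt u k | k <- iota 1 m] = vertex R (next c u).
  have := last_map_iota (pt u) 0 m; rewrite add0n pt0 => ->.
  by rewrite /pt tm edge_point1.
have last_loop q x : x \in c -> path (frel (next c)) x q ->
    last (vertex R x) (refine m x q) = vertex R (last x q).
  move: q x; apply: refine_ind => // x q xc IHq /=.
  by rewrite last_cat last_seg IHq.
have path_loop j q x : (j < m)%N -> x \in c -> path (frel (next c)) x q ->
    path (in_simplex K (f j) (f j.+1)) (vertex R x) (refine m x q).
  move=> jm; move: q x; apply: refine_ind => // x q xc IHq /=.
  rewrite cat_path last_seg IHq andbT.
  have := @path_map_iota _ (in_simplex K (f j) (f j.+1)) (pt x) 0 m.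
  rewrite pt0; apply => k /andP[_ km].
  (* The support at the corner (k, j) is the simplex that contains all four labels of the square. *)
  have [_ _ sK] := GK _ _ (ptA x k xc (ltnW km)) (ltnW jm).
  apply/existsP; eexists; apply/andP; split; first exact: sK.
  have near k' j' : (k' <= m)%N -> (j' <= m)%N -> (k' <= k.+1)%N -> (k <= k'.+1)%N ->
      (j' <= j.+1)%N -> (j <= j'.+1)%N -> f j' (pt x k') \in support (G (pt x k, t j)).
    move=> k'm j'm *; apply: top_vertex_near.
      exact: realization_barycentric (GK _ _ (ptA _ _ xc k'm) j'm).
    by apply: mesh => //; exact: ltnW.
  have kk2 i : (i <= i.+2)%N := leqW (leqnSn i).
  by apply/and4P; split; apply: near => //; exact: ltnW.
have loop_size : (0 < size loop)%N.
  by rewrite /loop; case: (p) => [|y q] /=; rewrite size_cat size_map size_iota ltn_addr.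
have loop_last : last (vertex R x0) loop = vertex R x0.
  by rewrite last_loop // last_rcons.
have p0K : realization R K p0.
  have [_ <- GI] := G_homotopy (ptA x0 0%N x0c (leq0n _)).
  by apply: GI; rewrite in_itv /= ler01 lexx.
have loopA q x : x \in c -> path (frel (next c)) x q -> forall y, y \in refine m x q -> A y.
  move: q x; apply: refine_ind => // x q xc IHq y /=; rewrite mem_cat => /orP[|/IHq//].
  by case/mapP=> k; rewrite mem_iota add1n ltnS => /andP[_ km] ->; apply: ptA.
have Av x : x \in c -> A (vertex R x).
  by move=> xc; have := ptA x 0%N xc (leq0n _); rewrite pt0.
(* Induction from the last row back: in row m the homotopy is constant, so all labels agree, and
   each strip hands trivial holonomy to the row before. *)
have rows j : (j <= m)%N -> forall b,
    transport tau (f (m - j)%N (vertex R x0)) (map (f (m - j)%N) loop) b = b.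
  elim: j => [|j IHj] jm b.
    rewrite subn0; have fm x : A x -> f m x = top_vertex x0 p0.
      by move=> Ax; rewrite /f tm; have [_ -> _] := G_homotopy Ax.
    have [_ _ sK] := p0K; have tp := top_vertex_support x0 (realization_barycentric p0K).
    rewrite (fm _ (Av _ x0c)) (transport_simplex tau_flat _ sK) //; last first.
      by move=> _ /mapP[y yl ->]; rewrite fm //; apply: loopA yl.
    rewrite -(fm _ (Av _ x0c)) last_map loop_last.
    by case: tau_flat => tau1 _; rewrite tau1.
  have mj : (m - j = (m - j.+1).+1)%N by rewrite subnS prednK // subn_gt0.
  apply: (transport_strip_loop tau_flat) loop_last _ b => //.
    by apply: path_loop => //; rewrite -mj leq_subr.
  by rewrite -mj; apply: IHj; apply: ltnW.
have f0 x : A x -> f 0 x = top_vertex x0 x.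
  by move=> Ax; rewrite /f t0; have [-> _ _] := G_homotopy Ax.
have fv x : x \in c -> f 0 (vertex R x) = x.
  by move=> xc; rewrite f0 ?top_vertex_vertex //; apply: Av.
(* At time 0 the labels on an edge of [c] are among its ends, so the subdivided edge acts like the
   edge itself. *)
have bottom q x : x \in c -> path (frel (next c)) x q -> forall b,
    transport tau x (map (f 0) (refine m x q)) b = transport tau x q b.
  move: q x; apply: refine_ind => // x q xc IHq b /=.
  have nc : next c x \in c by rewrite mem_next.
  have eK : [set x; next c x]%SET \in K.
    apply: (fintype.subsetP cK); rewrite finset.inE; apply/orP; right.
    exact: (imset_f (fun v => [set v; next c v]%SET)).
  pose sg := [seq pt x k | k <- iota 1 m].
  have lastE : last x (map (f 0) sg) = next c x.
    by rewrite -{1}(fv x xc) last_map last_seg fv.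
  rewrite map_cat transport_cat -/sg lastE IHq; congr transport.
  rewrite (transport_simplex tau_flat _ eK) ?finset.set21 ?lastE //.
  move=> _ /mapP[_ /mapP[k + ->] ->]; rewrite mem_iota add1n ltnS => /andP[_ km].
  rewrite f0; last exact: ptA.
  apply: (fintype.subsetP (support_edge_point _ _ (t k))); apply: top_vertex_support.
  by apply: edge_point_barycentric; apply: tI.
have := rows m (leqnn m) a; rewrite subnn fv // bottom //.
Qed.
End NullHomotopicHolonomy.

(** * Connectedness of a punctured disk in the plane *)

Section PuncturedPlane.
Variable R : realType.

(** Read as 0 and 1, [Q] is continuous on the interval; a change would force the value 1/2
    somewhere. *)
Lemma locally_constant_interval (Q : R -> bool) :
  (forall r : R, 0 <= r <= 1 -> \forall r' \near r, Q r' = Q r) -> Q 0 = Q 1.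
Proof.
move=> Qloc; pose phi r : R := (Q r)%:R.
have cphi : {within `[0, 1], continuous phi}.
  apply/subspace_continuousP => r; rewrite /= in_itv /= => /Qloc Qr.
  apply: cvg_near_cst; rewrite near_withinE; apply: filterS Qr => r' rE _.
  by rewrite /from_subspace /phi rE.
apply/eqP; apply: contraT => Q01.
have [|r _] := IVT (v := 2^-1) ler01 cphi.
  rewrite ge_min le_max /phi; case: (Q 0) (Q 1) Q01 => [] [] //= _;
    by apply/andP; split; apply/orP; first [left; lra | right; lra].
by rewrite /phi; case: (Q r) => /= E; lra.
Qed.

Variables (w0 : 'rV[R]_2) (e : R) (Q : 'rV[R]_2 -> bool).
Hypothesis e_gt0 : 0 < e.
Hypothesis Q_loc : forall w, ball w0 e w -> w != w0 -> \forall w' \near w, Q w' = Q w.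

Let i0 : 'I_2 := ord0.
Let i1 : 'I_2 := ord_max.

Lemma rV2P (x y : 'rV[R]_2) : x ord0 i0 = y ord0 i0 -> x ord0 i1 = y ord0 i1 -> x = y.
Proof.
move=> E0 E1; apply/rowP => i; have [->//|->//] : i = i0 \/ i = i1.
by case: i => -[|[|//]] ?; [left|right]; apply/val_inj.
Qed.

Lemma segment_constant d1 d2 : ball w0 e (w0 + d1) -> ball w0 e (w0 + d2) ->
  (forall r : R, 0 <= r <= 1 -> (1 - r) *: d1 + r *: d2 != 0) ->
  Q (w0 + d1) = Q (w0 + d2).
Proof.
move=> [_ b1] [_ b2] avoid.
pose g (r : R) : 'rV[R]_2 := w0 + ((1 - r) *: d1 + r *: d2).
have g0 : g 0 = w0 + d1 by rewrite /g subr0 scale1r scale0r addr0.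
have g1 : g 1 = w0 + d2 by rewrite /g subrr scale1r scale0r add0r.
rewrite -g0 -g1; apply: (@locally_constant_interval (Q \o g)) => r rI.
have cg : continuous g.
  move=> x; apply: cvgD; first exact: cvg_cst.
  apply: cvgD; apply: cvgZr_tmp; last exact: cvg_id.
  by apply: cvgB; [exact: cvg_cst | exact: cvg_id].
have gr : ball w0 e (g r).
  split=> // i j; have := b1 i j; have := b2 i j; rewrite /ball /= !mxE.
  have [r0 r1] := andP rI; rewrite !opprD !addrA !subrr !add0r !normrN => h2 h1.
  have conv (a b : R) : a < e -> b < e -> (1 - r) * a + r * b < e.
    move=> ae be; have [m [am bm me]] : exists m, [/\ a <= m, b <= m & m < e].
      by exists (Num.max a b); rewrite !le_max !lexx orbT gt_max ae be.
    have r1' : 0 <= 1 - r by rewrite subr_ge0.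
    have := ler_wpM2l r1' am; have := ler_wpM2l r0 bm; lra.
  move: h1 h2; rewrite -opprD normrN !ltr_norml ![- e < _]ltrNl => /andP[? ?] /andP[? ?].
  by rewrite conv // opprD -!mulrN conv.
have gn : g r != w0.
  by rewrite /g -subr_eq0 addrC addKr avoid.
exact: (cg r _ (Q_loc gr gn)).
Qed.

Definition quarter_turn (d : 'rV[R]_2) : 'rV[R]_2 :=
  \row_j (if j == ord0 then - d ord0 i1 else d ord0 i0).

(** The segment from [d1] to its quarter turn [d3] misses 0 by independence. If the one from [d3] to
    [d2] meets 0, then [d2] points opposite to [d3] and the segment from [d1] to [d2] misses 0. The
    ball is a square, so it contains the turned point. *)
Lemma punctured_ball_constant w1 w2 :
  ball w0 e w1 -> ball w0 e w2 -> w1 != w0 -> w2 != w0 -> Q w1 = Q w2.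
Proof.
move=> b1 b2 n1 n2.
pose d1 := w1 - w0; pose d2 := w2 - w0; pose d3 := quarter_turn d1.
have w1E : w1 = w0 + d1 by rewrite addrC subrK.
have w2E : w2 = w0 + d2 by rewrite addrC subrK.
have b3 : ball w0 e (w0 + d3).
  have bd k : `|d1 ord0 k| < e.
    by case: b1 => _ /(_ ord0 k); rewrite /ball /= distrC !mxE.
  split=> // i j; rewrite /ball /= [i]ord1.
  have -> : w0 ord0 j - (w0 + d3) ord0 j = - d3 ord0 j by rewrite mxE; ring.
  by rewrite normrN mxE; case: ifP => _; rewrite ?normrN.
have nd1 : d1 != 0 by rewrite subr_eq0.
have nd2 : d2 != 0 by rewrite subr_eq0.
have d30 : d3 ord0 i0 = - d1 ord0 i1 by rewrite mxE.
have d31 : d3 ord0 i1 = d1 ord0 i0 by rewrite mxE.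
have sq : 0 < d1 ord0 i0 ^+ 2 + d1 ord0 i1 ^+ 2.
  rewrite lt_neqAle eq_sym addr_ge0 ?sqr_ge0 // andbT paddr_eq0 ?sqr_ge0 // !sqrf_eq0.
  by apply: contra nd1 => /andP[/eqP E0 /eqP E1]; apply/eqP/rV2P; rewrite !mxE in E0 E1 *.
have indep x y : x *: d1 + y *: d3 = 0 -> x = 0 /\ y = 0.
  move=> /rowP E; have := E i0; have := E i1.
  rewrite ![(_ + _ : 'rV_2) _ _]mxE ![(_ *: _ : 'rV_2) _ _]mxE ![(0 : 'rV_2) _ _]mxE d30 d31.
  move: (d1 ord0 i0) (d1 ord0 i1) sq => a b sq E1 E0.
  have /eqP : x * (a ^+ 2 + b ^+ 2) = 0.
    by rewrite -[RHS](_ : (x * b + y * a) * b + (x * a + y * - b) * a = 0);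
      [ring | rewrite E0 E1 !mul0r addr0].
  have /eqP : y * (a ^+ 2 + b ^+ 2) = 0.
    by rewrite -[RHS](_ : (x * b + y * a) * a - (x * a + y * - b) * b = 0);
      [ring | rewrite E0 E1 !mul0r subr0].
  by rewrite !mulf_eq0 (gt_eqF sq) !orbF => /eqP-> /eqP->.
have Q13 : Q w1 = Q (w0 + d3).
  rewrite w1E; apply: segment_constant; rewrite -?w1E // => r rI.
  apply/eqP => /indep[r1 r0]; move: r1; rewrite r0 subr0 => /eqP.
  by rewrite oner_eq0.
have [[s sI sE]|no] := pselect (exists2 s : R, 0 <= s <= 1 & (1 - s) *: d3 + s *: d2 = 0).
  rewrite w1E w2E; apply: segment_constant; rewrite -?w1E -?w2E // => r rI.
  apply/eqP => rE; have : (s * (1 - r)) *: d1 + (- (r * (1 - s))) *: d3 = 0.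
    have -> : (s * (1 - r)) *: d1 + (- (r * (1 - s))) *: d3 =
        s *: ((1 - r) *: d1 + r *: d2) - r *: ((1 - s) *: d3 + s *: d2).
      by apply/rowP => j; rewrite !mxE; ring.
    by rewrite rE sE !scaler0 subrr.
  have s_neq0 : s != 0.
    apply/eqP=> s0; have d3_0 : 0 *: d1 + 1 *: d3 = 0.
      by rewrite scale0r add0r scale1r -sE s0 subr0 scale1r scale0r addr0.
    by have [_ /eqP] := indep _ _ d3_0; rewrite oner_eq0.
  case/indep=> /eqP; rewrite mulf_eq0 (negPf s_neq0) subr_eq0 /= => /eqP r1 /eqP.
  rewrite -r1 mul1r oppr_eq0 subr_eq0 => /eqP s1.
  by move: rE; rewrite -r1 subrr scale0r add0r scale1r => /eqP; rewrite (negPf nd2).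
rewrite Q13 w2E; apply: segment_constant; rewrite -?w2E // => r rI.
by apply/eqP => rE; apply: no; exists r.
Qed.

End PuncturedPlane.

(** * The two implications on a triangulated surface *)

Section TriangulatedSurface.
Variables (R : realType) (S : topologicalType) (n : nat) (K : {set {set 'I_n}}).
Variable h : 'rV[R]_n -> S.
Hypothesis hS : closed_surface R S.
Hypothesis hK : triangulation K h.
Let tri := triangles K.

Lemma card_triangles : {in tri, forall t : {set 'I_n}, #|t| = 3%N}.
Proof. by move=> t; rewrite inE => /andP[_ /eqP]. Qed.

Lemma triangles_edge2 (e t : {set 'I_n}) : #|e| = 2%N -> t \in tri -> e \subset t ->
  #|[set s in tri | e \subset s]%SET| = 2%N.
Proof.
case: hK => [[_ _ Ksub] _ Kedge _] e2 tT et; apply: Kedge => //.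
apply: Ksub et _; first by move: tT; rewrite inE => /andP[].
by rewrite -card_gt0 e2.
Qed.

(* Otherwise the star of v minus v splits into two open pieces accumulating at v,
   while a punctured disk in the plane is connected. *)
Lemma star_connected (v : 'I_n) (t t' : {set 'I_n}) :
  t \in tri -> t' \in tri -> v \in t -> v \in t' ->
  connect (fun a b => tri_adj tri a b && (v \in a :&: b)%SET) t t'.
Proof.
move=> tT t'T vt vt'.
case: (hK) => [[K0 Kv Ksub] Kpure Kedge [hinv [hB hiB [hinvK hK'] ch chi]]].
case: hS => [_ _ _ _ charts]; pose p := h (vertex R v).
have [U [W [f [oU Up oW [g [fUW gWU [gf fg] cf cg]]]]]] := charts p.
set r := (fun a b => _).
have rsym : symmetric r by move=> a b; rewrite /r tri_adj_sym finset.setIC.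
pose P s := connect r t s.
have Pedge (s1 s2 : {set 'I_n}) u : s1 \in tri -> s2 \in tri -> u != v -> u \in s1 ->
    v \in s1 -> u \in s2 -> v \in s2 -> P s1 = P s2.
  move=> s1T s2T uv us1 vs1 us2 vs2; have [->//|ns] := eqVneq s1 s2.
  apply: (same_connect_r (sym_connect_sym rsym)); apply: connect1.
  have e2 : #|[set u; v]%SET| = 2%N by rewrite cards2 uv.
  rewrite /r (edge_tri_adj card_triangles s1T s2T ns e2) ?sub2_set ?us1 ?us2 //=.
  by rewrite finset.inE vs1.
have vK : realization R K (vertex R v).
  by rewrite -(edge_point0 R v v); apply: realization_edge; rewrite ?finset.setUid ?lexx ?ler01.
pose psi w := hinv (g w); pose w0 := f p.
have Ww0 : W w0 by apply: fUW.
have psi0 : psi w0 = vertex R v by rewrite /psi gf // hinvK.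
have psiK w : realization R K (psi w) by apply: hiB.
have cpsi w : W w -> {for w, continuous psi}.
  move=> Ww; have : {within W, continuous psi}.
    exact: (@within_continuous_comp _ _ _ _ [set: S] g hinv).
  by rewrite continuous_open_subspace // => /(_ w); apply; rewrite inE.
have cpsi_coord w i : W w -> 0 < psi w ord0 i -> \forall w' \near w, 0 < psi w' ord0 i.
  move=> Ww x0; have ci : {for w, continuous (fun w' => psi w' ord0 i)}.
    apply: (@continuous_comp _ _ _ psi (fun x : 'rV[R]_n => x ord0 i)); first exact: cpsi.
    exact: coord_continuous.
  exact: (ci _ (lt_nbhsr x0)).
have [e e0 we] : exists2 e : R, 0 < e & forall w, ball w0 e w -> W w /\ 0 < psi w ord0 v.
  have : \forall w \near w0, W w /\ 0 < psi w ord0 v.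
    apply: filterI; first exact: open_nbhs_nbhs.
    by apply: cpsi_coord => //; rewrite psi0 !mxE !eqxx ltr01.
  by case/nbhs_ballP=> e /= e0 we; exists e.
have psi_pos w i : i \in support (psi w) -> 0 < psi w ord0 i.
  by rewrite finset.inE lt_neqAle eq_sym => -> /=; have [] := psiK w.
pose Q w := [exists s in tri, P s && (support (psi w) \subset s)].
have psi_inj w : W w -> psi w = vertex R v -> w = w0.
  by move=> Ww E; rewrite -(fg w Ww) -(hK' (g w) I) -/(psi w) E.
(* A point of the chart other than [w0] has a second vertex [u] in its support. Nearby supports
   contain this one, so all triangles involved share the edge [uv] and agree on [P]. *)
have Q_loc w : ball w0 e w -> w != w0 -> \forall w' \near w, Q w' = Q w.
  move=> /we[Ww xv] nw.
  have vx : v \in support (psi w) by rewrite finset.inE gt_eqF.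
  have [u uv ux] : exists2 u, u != v & u \in support (psi w).
    apply/exists_inP; apply: contraNT nw => /exists_inPn none; apply/eqP/psi_inj => //.
    have z i : i != v -> psi w ord0 i = 0.
      by move=> iv; apply/eqP; have := none i iv; rewrite finset.inE negbK.
    have [_ + _] := psiK w; rewrite (bigD1 v) //= big1 // addr0 => one.
    apply/rowP => i; rewrite mxE eqxx /=; have [->//|/z->//] := eqVneq i v.
  have near_supp : \forall w' \near w, forall i, i \in support (psi w) -> 0 < psi w' ord0 i.
    apply: (@filter_forall _ _
      (fun i w' => i \in support (psi w) -> 0 < psi w' ord0 i) (nbhs w)) => i.
    have [ix|ix] := boolP (i \in support (psi w)); last exact: nearW.
    by apply: filterS (cpsi_coord w i Ww (psi_pos _ _ ix)) => w'.
  apply: filterS near_supp => w' pos.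
  have sub : support (psi w) \subset support (psi w').
    by apply/fintype.subsetP => i /pos; rewrite finset.inE => /gt_eqF->.
  have [_ _ /Kpure[s' s'T xs']] := psiK w'.
  have xs'' := fintype.subset_trans sub xs'.
  apply/exists_inP/exists_inP => -[s sT /andP[Ps xs]].
    by exists s => //; rewrite Ps; apply: fintype.subset_trans xs.
  have /fintype.subsetP xs1 := xs; have /fintype.subsetP xs2 := xs''.
  by exists s' => //; rewrite xs' andbT -(Pedge s s' u) // ?xs1 ?xs2.
(* Points on the edge from [v] to another vertex [u] of [s] come arbitrarily near to [v], and there
   [Q] has the value [P s]. *)
have approach s : s \in tri -> v \in s -> exists w, [/\ ball w0 e w, w != w0 & Q w = P s].
  move=> sT vs; have [u us uv] : exists2 u, u \in s & u != v.
    have : (0 < #|(s :\ v)%SET|)%N.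
      by have := cardsD1 v s; rewrite vs (card_triangles sT) add1n => -[<-].
    by case/card_gt0P=> u; rewrite !finset.inE => /andP[]; exists u.
  have sK : s \in K by move: sT; rewrite finset.inE => /andP[].
  pose x (a : R) := edge_point v u a.
  have xK a : 0 <= a <= 1 -> realization R K (x a).
    apply: realization_edge => //; apply: (Ksub s) => //.
      by rewrite sub2_set vs.
    by rewrite -card_gt0 cards2.
  have cx : {within `[0, 1], continuous (h \o x)}.
    apply: (within_continuous_comp _ _ ch); last first.
      by apply: continuous_subspaceT; exact: edge_point_continuous.
    by move=> a /=; rewrite in_itv; apply: xK.
  have x0 : x 0 = vertex R v by rewrite /x edge_point0.
  have near_p : \forall y \near p, U y /\ ball w0 e (f y).
    apply: filterI; first exact: open_nbhs_nbhs.
    have : {for p, continuous f}.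
      by move: cf; rewrite continuous_open_subspace // => /(_ p); apply; rewrite inE.
    by apply; exact: nbhsx_ballx.
  have : \forall a \near within `[(0 : R), 1] (nbhs (0 : R)),
      U (h (x a)) /\ ball w0 e (f (h (x a))).
    move/subspace_continuousP: cx => /(_ 0); rewrite /= in_itv /= lexx ler01 => /(_ isT).
    move=> cvg0; have near_p0 : nbhs ((h \o x) 0) [set y | U y /\ ball w0 e (f y)].
      by rewrite /= x0.
    exact: (cvg0 _ near_p0).
  rewrite near_withinE => /nbhs_ballP[d /= d0 da].
  pose a := Num.min (d / 2) (1 / 2).
  have [a0 ad a1] : [/\ 0 < a, a < d & a < 1].
    rewrite lt_min !gt_min; split.
    - by apply/andP; split; lra.
    - by apply/orP; left; lra.
    - by apply/orP; right; lra.
  have aI : 0 <= a <= 1 by rewrite !ltW.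
  have [||Uxa ba] := da a; first by rewrite /ball /= sub0r normrN gtr0_norm.
    by rewrite /= in_itv.
  have psia : psi (f (h (x a))) = x a by rewrite /psi gf // hinvK //; apply: xK.
  have ux : u \in support (x a).
    by rewrite finset.inE edge_pointE eqxx (negPf uv) mulr0 add0r mulr1 gt_eqF.
  have vx : v \in support (x a).
    rewrite finset.inE edge_pointE eqxx [v == u]eq_sym (negPf uv).
    by rewrite mulr0 addr0 mulr1 gt_eqF ?subr_gt0.
  exists (f (h (x a))); split=> //.
    apply/eqP => E; move: ux; rewrite -psia E psi0 finset.inE !mxE eqxx (negPf uv).
    by rewrite eqxx.
  apply/exists_inP/idP => [[s1 s1T /andP[Ps1]]|Ps].
    rewrite psia => /fintype.subsetP xs1.
    by rewrite -(Pedge s1 s u) //; apply: xs1.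
  exists s => //; rewrite Ps psia; apply: fintype.subset_trans (support_edge_point _ _ _) _.
  by rewrite sub2_set vs.
have [w1 [b1 n1 Q1]] := approach t tT vt; have [w2 [b2 n2 Q2]] := approach t' t'T vt'.
by rewrite -/(P t') -Q2 -(punctured_ball_constant e0 Q_loc b1 b2 n1 n2) Q1 /P connect0.
Qed.

Variable q : nat.
Hypothesis hq : equivelar K q.

Lemma carrier_realization (U : {set {set 'I_n}}) : U \subset tri ->
  carrier U `<=` realization R K.
Proof.
move=> UT x [bx [t tU xt]]; case: (bx) => x0 x1; split=> //.
case: hK => [[_ _ Ksub] _ _ _]; apply: Ksub xt (barycentric_support bx).
by have := fintype.subsetP UT t tU; rewrite finset.inE => /andP[].
Qed.

Lemma proper_tree_hamiltonian (T : graph {set 'I_n}) :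
  proper_tree (dual_map K) n q T ->
  exists c, hamiltonian_cycle (edge_graph K) c /\ contractible_cycle h c.
Proof.
case=> [[Tgraph TV Tadj] Ttree Tcard Tface _].
case: (hK) => [[_ Kv Ksub] Kpure _ hom].
(* A nonempty surface has a triangle; hence [n - 2] is not truncated and the tree is not empty. *)
have n3 : (2 < n)%N.
  case: hS => [[s _] _ _ _ _]; case: hom => hinv [_ hinvK _ _ _].
  have [_ _ /Kpure[t tT _]] := hinvK s I.
  by rewrite -(card_triangles tT) -[n in (_ <= n)%N]card_ord max_card.
have T0 : gverts T != finset.set0 by rewrite -card_gt0 Tcard subn_gt0.
have st : stacked (gverts T).
  apply: (tree_stacked (tri := tri)) => //; first exact: card_triangles.
  move=> v t t' tV t'V vt vt'.
  have [||p [/and3P[_ pT _] /and3P[_ pF _] <-]] := Tface v t t' tV t'V.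
  - by rewrite finset.inE vt (fintype.subsetP TV).
  - by rewrite finset.inE vt' (fintype.subsetP TV).
  apply/connectP; exists p => //; move: pT pF; elim: (p) (t) => //= s p' IHp x.
  by case/andP=> -> /IHp IH /andP[/andP[_ ->] /IH].
have [c [Uc sc cE cyc _]] := stacked_boundary card_triangles triangles_edge2 st TV.
have cn : size c = n by rewrite sc Tcard -addn2 subnK // ltnW.
have call v : v \in c.
  have /uniq_min_size : {subset c <= enum 'I_n} by move=> x _; rewrite mem_enum.
  by case/(_ Uc); [rewrite size_enum_ord cn | move=> _ ->; rewrite mem_enum].
have sc2 : (2 < size c)%N by rewrite cn.
have next_tri v : exists2 t, t \in gverts T & [set v; next c v]%SET \subset t.
  by have /existsP[t /andP[tT vt]] := next_cycle cyc (call v); exists t.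
have TK t : t \in gverts T -> t \in K.
  by move=> /(fintype.subsetP TV); rewrite finset.inE => /andP[].
exists c; split.
  split; last by move=> v; rewrite call finset.inE.
  rewrite /cycle_in sc2 Uc andbT; apply: cycle_from_next => // v _ /=.
  rewrite next_neq //=; have [t tT vt] := next_tri v.
  by apply: Ksub vt _; rewrite ?TK // -card_gt0 cards2.
(* Consecutive vertices of [c] share a triangle of the tree, so [c] runs in the stacked disk, whose
   contraction restricts to it. *)
have cT : realization R (cycle_complex c) `<=` carrier (gverts T).
  move=> x Ax; have bx := realization_barycentric Ax; split=> //.
  case: Ax => _ _; rewrite finset.inE => /orP[]/imsetP[v _ xE].
    have [t tT vt] := next_tri v; exists t => //; rewrite /support xE.
    by apply: fintype.subset_trans vt; rewrite finset.sub1set finset.set21.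
  by have [t tT vt] := next_tri v; exists t => //; rewrite /support xE.
have TR := carrier_realization TV.
have AK : realization R (cycle_complex c) `<=` realization R K by move=> x /cT/TR.
apply/(null_homotopic_homeo R hom AK).
have [G [p [cG G0 GT]]] := stacked_contractible R st.
exists G, p; split; first exact: continuous_subspaceT.
move=> x /cT xT; have [G1 GI] := GT x xT; split=> // s.
by rewrite in_itv => sI; apply: TR; apply: GI.
Qed.

Lemma face_vertsE (v : 'I_n) (t : {set 'I_n}) :
  (t \in gverts (map_face (dual_map K) v)) = (t \in tri) && (v \in t).
Proof. exact: finset.in_set. Qed.

Lemma hamiltonian_proper_tree (c : seq 'I_n) :
  hamiltonian_cycle (edge_graph K) c -> contractible_cycle h c ->
  exists T : graph {set 'I_n}, proper_tree (dual_map K) n q T.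
Proof.
case=> /and3P[sc cyc Uc] cE cnull; case: (hK) => [[_ Kv Ksub] Kpure _ hom].
have call v : v \in c by rewrite cE finset.inE.
have ctri : cycle (coface tri) c.
  apply: sub_cycle cyc => u v /andP[_ /Kpure[t tT uvt]].
  by apply/existsP; exists t; rewrite tT.
have cK : cycle_complex c \subset K.
  apply/fintype.subsetP => s; rewrite finset.inE => /orP[]/imsetP[v vc ->] //.
  by have /andP[] := next_cycle cyc vc.
have cR : realization R (cycle_complex c) `<=` realization R K.
  by move=> x [x0 x1 xc]; split=> //; apply: (fintype.subsetP cK).
have [G [p [cG Gp]]] := (null_homotopic_homeo R hom cR).1 cnull.
(* Every simplex of [K] lies in a triangle, so flatness on triangles extends to [K]. *)
have hol (X : Type) (tau : 'I_n -> 'I_n -> X -> X) : flat_transport tri tau ->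
    forall x s, c = x :: s -> forall a, transport tau x (rcons s x) a = a.
  move=> [tau1 tauM] x s; apply: (null_homotopic_holonomy cG Gp cK _ Uc).
  split=> // r /Kpure[t tT /fintype.subsetP rt] u v w a ur vr wr.
  by apply: (tauM t) => //; apply: rt.
have [T [Ttree [TV Tadj] Tcard Tface Tother]] := hamiltonian_tree card_triangles
  triangles_edge2 Uc sc call ctri hol star_connected.
exists T; have [Tgraph _ _] := Ttree; have [_ _ Tends] := Tgraph.
split=> //.
- by apply/eqP; rewrite -(eqn_add2r 2) Tcard card_ord subnK // -(card_ord n) -Tcard addn2.
- move=> v u1 u2 u1T u2T; rewrite !face_vertsE => /andP[u1K vu1] /andP[u2K vu2].
  have /connectP[p0 pth0 ->] := Tface v u1 u2 u1T u2T vu1 vu2.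
  case: (shortenP pth0) => p' pth Up' _; exists p'; split=> //.
    by rewrite /path_in u1T Up' andbT /=; apply: sub_path pth => x y /andP[].
  rewrite /path_in Up' andbT face_vertsE u1K vu1 /=.
  by apply: sub_path pth => x y /andP[/Tadj xy vxy]; rewrite -/(tri_adj tri x y) xy.
(* The path visits distinct triangles at [v] other than [t0], which is off the tree: at most q - 1
   of them, hence at most q - 2 edges. *)
- move=> v u s /and3P[uT pthT Us] /and3P[uF pthF _].
  pose star := gverts (map_face (dual_map K) v).
  have [t0 [t0T vt0 t0V]] := Tother v.
  have cstar : #|star| = q by apply: hq.
  have t0s : t0 \in star by rewrite face_vertsE t0T.
  have sub : {subset u :: s <= enum (star :\ t0)%SET}.
    move=> x xs; rewrite mem_enum finset.in_setD1.
    have xT : x \in gverts T.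
      elim: (s) (u) uT pthT x xs => [|y s' IHs] z zT /=.
        by move=> _ x; rewrite inE => /eqP->.
      move=> /andP[/Tends/andP[_ yT] pth] x; rewrite inE => /orP[/eqP->//|].
      exact: IHs.
    have xF : x \in star.
      move: uF pthF x xs {xT}; elim: (s) (u) => [|y s' IHs] z zT /=.
        by move=> _ x; rewrite inE => /eqP->.
      move=> /andP[/andP[/and3P[_ yT _] /finset.setIP[_ vy]] pth] x.
      rewrite inE => /orP[/eqP->//|]; apply: IHs => //.
      by rewrite face_vertsE yT vy.
    by rewrite xF andbT; apply: contraNneq t0V => <-.
  have := uniq_leq_size Us sub; rewrite -cardE.
  have := cardsD1 t0 star; rewrite t0s cstar add1n => -> /=.
  by case: #|_| => // m; rewrite ltnS subn2.
Qed.

End TriangulatedSurface.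

Theorem theorem1 (R : realType) (S : topologicalType) (n q : nat)
    (K : {set {set 'I_n}}) (h : 'rV[R]_n -> S)
    (hS : closed_surface R S) (hK : triangulation K h) (hq : equivelar K q) :
  (exists c : seq 'I_n,
     hamiltonian_cycle (edge_graph K) c /\ contractible_cycle h c)
  <->
  (exists T : graph {set 'I_n}, proper_tree (dual_map K) n q T).
Proof.
split=> [[c [cH cnull]]|[T]]; first exact: hamiltonian_proper_tree cH cnull.
exact: proper_tree_hamiltonian.
Qed.
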